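(* Let $H$ be a real Hilbert space of dimension at least two. Then there exist two self-adjoint coercive operators $A_1$ and $A_2$ on $H$ with $A_1<A_2$ (in the sense that $A_2-A_1$ is a positive operator), but such that $K(A_1,c)<K(A_2,c)$ when $c$ is large enough.
   Context: A self-adjoint operator $A$ on $H$ with dense domain $D(A)$ is coercive if there is $b>0$ with $\langle Av,v\rangle\ge b\|v\|_H^2$ for every $v\in D(A)$. For such $A$ and for $c>0$, consider the equation $u''(t)+cu'(t)+Au(t)=f(t)$, written as a first order equation for $U=(u,u')$ in the phase space $\mathbb{X}:=D(A^{1/2})\times H$; its solutions are understood as mild solutions, i.e. weak solutions $u\in C^0([0,+\infty),D(A^{1/2}))\cap C^1([0,+\infty),H)$ (and similarly on $\mathbb{R}$ for global solutions). The optimal velocity bound $K(A,c)$ is the smallest constant $K$ such that $$\limsup_{t\to+\infty}\|u'(t)\|_H\le K\limsup_{t\to+\infty}\|f(t)\|_H$$ for every $f:(0,+\infty)\to H$ that is integrable on $(0,T)$ for every $T>0$ and satisfies $\limsup_{t\to+\infty}\|f(t)\|_H<+\infty$, and for every weak solution $u$; here $\limsup_{t\to+\infty}\|f(t)\|_H:=\lim_{T\to+\infty}\|f\|_{L^\infty((T,+\infty),H)}$. This constant coincides with the smallest $K$ such that $\|u'(t)\|_H\le K\|f\|_{L^\infty(\mathbb{R},H)}$ for all $t\in\mathbb{R}$ (equivalently, only for $t=0$) and all $f\in L^\infty(\mathbb{R},H)$, where $u$ is the unique weak solution on $\mathbb{R}$ such that $(u,u')$ is bounded in $\mathbb{X}$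 on the whole real line. ''When $c$ is large enough'' means: there exists $c_0>0$ such that the inequality holds for every $c\ge c_0$. A positive operator $T$ is one with $\langle Tx,x\rangle>0$ for every $x\neq0$ in its domain. *)

(* Defs.v *)
From mathcomp Require Import all_boot all_order all_algebra.
From mathcomp Require Import sesquilinear.
From mathcomp Require Import all_classical all_reals all_analysis.

Set Implicit Arguments.
Unset Strict Implicit.
Unset Printing Implicit Defensive.

Import Order.TTheory GRing.Theory Num.Theory.
Import numFieldNormedType.Exports.

Local Open Scope classical_set_scope.
Local Open Scope ring_scope.

(* With [H : completeNormedModType R], this makes H a real Hilbert space. *)
Definition inner_product_of_norm (R : realType) (H : completeNormedModType R)
    (ip : {dot H for idfun}) : Prop :=
  forall x : H, ip x x = `|x| ^+ 2.

Definition dim_ge2 (R : realType) (H : lmodType R) : Prop :=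
  exists x y : H, forall a b : R, a *: x + b *: y = 0 -> a = 0 /\ b = 0.

(* Possibly unbounded operators: the values of [opfun] outside [opdom] are
   irrelevant. *)
Record operator (H : Type) := Operator {
  opdom : set H;
  opfun :> H -> H
}.

Definition op_sub (H : zmodType) (S T : operator H) : operator H :=
  Operator (opdom S `&` opdom T) (fun x => S x - T x).

Definition linear_op (R : realType) (H : lmodType R) (T : operator H) : Prop :=
  opdom T 0 /\
  forall (a : R) (x y : H), opdom T x -> opdom T y ->
    opdom T (a *: x + y) /\ T (a *: x + y) = a *: T x + T y.

Section hilbert.
Context (R : realType) (H : completeNormedModType R) (ip : {dot H for idfun}).
Implicit Types (A B T : operator H).

(* (v, w) belongs to the graph of the adjoint of T. *)
Definition adjoint_graph T (v w : H) : Prop :=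
  forall x, opdom T x -> ip (T x) v = ip x w.

Definition self_adjoint T : Prop :=
  [/\ linear_op T, dense (opdom T) &
      forall v w, adjoint_graph T v w <-> opdom T v /\ T v = w].

Definition coercive A : Prop :=
  exists2 b : R, 0 < b & forall v, opdom A v -> b * `|v| ^+ 2 <= ip (A v) v.

Definition positive_op T : Prop :=
  forall x, opdom T x -> x != 0 -> 0 < ip (T x) x.

(* B = A^{1/2}: the nonnegative self-adjoint operator with B \o B = A, domains
   included. *)
Definition is_sqrt_op A B : Prop :=
  [/\ self_adjoint B,
      forall x, opdom B x -> 0 <= ip (B x) x,
      forall x, opdom A x <-> opdom B x /\ opdom B (B x) &
      forall x, opdom A x -> A x = B (B x)].

Definition simple_fun (s : R -> H) : Prop :=
  finite_set (range s) /\ forall x : H, measurable (s @^-1` [set x]).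

(* Every Bochner measurable class has a representative of this form, for the
   Borel sigma-algebra that carries lebesgue_measure. Changing f on a null set
   affects neither the equation below nor the essential limsup. *)
Definition strongly_measurable (D : set R) (f : R -> H) : Prop :=
  exists s : nat -> R -> H, (forall n, simple_fun (s n)) /\
    forall t, D t -> s n t @[n --> \oo] --> f t.

Definition bochner_integrable (D : set R) (f : R -> H) : Prop :=
  strongly_measurable D f /\
  (\int[lebesgue_measure]_(t in D) (`|f t|%:E) < +oo)%E.

(* The norm of f in L^oo((T, +oo), H). *)
Definition Loo_norm_after (f : R -> H) (T : R) : \bar R :=
  ('N[mrestr (@lebesgue_measure R) (measurable_itv `]T, +oo[)]_+oo
     [(fun t => `|f t|%:E)])%E.

Definition ess_limsup_norm (f : R -> H) : \bar R :=
  lim (Loo_norm_after f T @[T --> +oo%R]).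

Definition limsup_norm (v : R -> H) : \bar R :=
  limf_esup (fun t => `|v t|%:E) (pinfty_nbhs R).

(* Derivative relative to [0, +oo): one-sided at t = 0. *)
Definition derivative_on_nonneg (u v : R -> H) : Prop :=
  forall t : R, 0 <= t ->
    (s - t)^-1 *: (u s - u t)
      @[s --> within [set s | 0 <= s /\ s != t] (nbhs t)] --> v t.

(* u, with v = u', is a weak solution of u'' + c u' + A u = f on [0, +oo).
   Continuity in D(A^{1/2}) is for the graph norm of B = A^{1/2}. The last
   clause says that <u', w> is locally absolutely continuous with
   <u', w>' + c <u', w> + <B u, B w> = <f, w> almost everywhere. *)
Definition weak_solution A (c : R) (f u v : R -> H) : Prop :=
  exists2 B, is_sqrt_op A B &
  [/\ forall t : R, 0 <= t -> opdom B (u t),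
      {within `[0, +oo[, continuous u},
      {within `[0, +oo[, continuous (B \o u)},
      derivative_on_nonneg u v /\ {within `[0, +oo[, continuous v} &
      forall (w : H) (t : R), opdom B w -> 0 <= t ->
        ip (v t) w = ip (v 0) w +
          \int[lebesgue_measure]_(s in `]0, t[)
            (ip (f s) w - c * ip (v s) w - ip (B (u s)) (B w))].

Definition velocity_bound A (c K : R) : Prop :=
  forall f u v : R -> H,
    (forall T : R, 0 < T -> bochner_integrable `]0, T[ f) ->
    (ess_limsup_norm f < +oo)%E ->
    weak_solution A c f u v ->
    (limsup_norm v <= K%:E * ess_limsup_norm f)%E.

Definition optimal_velocity_bound A (c K : R) : Prop :=
  velocity_bound A c K /\ forall K', velocity_bound A c K' -> K <= K'.

End hilbert.

(* Main.v *)
(* Take [A1] a multiple of the identity and [A2] with eigenvalue [a] on the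
   orthogonal complement of a unit vector and [b] on that vector, where
   [A1 < a < b].

   Along an eigenvector with eigenvalue [l], let [r1], [r2] be the roots of
   [X^2 - c X + l]. The equation factors into two first order equations with
   damping rates [r1] and [r2], and this bounds the velocity by [2 F / r2]
   with [r2 ~ c]. Hence [c K(A1, c)] is asymptotically at most [2].

   For [A2] rescale time: with [u t = U (t / c)] the forcing is
   [U' + A2 U + U'' / c^2], so [c K(A2, c)] is asymptotically at least
   [sup |U'| / sup |U' + A2 U|] for every periodic plane curve [U]. This ratio
   is at most [2] for a single eigenvalue (a jump of the forcing from [1] to
   [-1] after saturation), but two very different eigenvalues allow it to exceed
   [2]: while the fast component undergoes such a jump, the slow component
   still remembers the average of its own forcing, which is active at other
   times. *)
Require Import Defs.
From mathcomp Require Import all_boot all_order all_algebra.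
From mathcomp Require Import sesquilinear.
From mathcomp Require Import all_classical all_reals all_analysis.
From mathcomp Require Import measurable_realfun ess_sup_inf ring lra.
Import Order.TTheory GRing.Theory Num.Theory.
Import numFieldNormedType.Exports.
Set Implicit Arguments.
Unset Strict Implicit.
Unset Printing Implicit Defensive.
Local Open Scope classical_set_scope.
Local Open Scope ring_scope.

(** * Spectral operators *)

Section inner_product.
Context (R : realType) (H : completeNormedModType R) (ip : {dot H for idfun}).
Hypothesis ip_norm : inner_product_of_norm ip.
Implicit Types (x y z e : H) (a b : R).

Lemma ipC x y : ip x y = ip y x.
Proof. by rewrite hermC expr0 mul1r. Qed.

Lemma ipDl x y z : ip (x + y) z = ip x z + ip y z.
Proof. exact: linearDl. Qed.

Lemma ipZl a x y : ip (a *: x) y = a * ip x y.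
Proof. exact: linearZl_LR. Qed.

Lemma ipDr x y z : ip x (y + z) = ip x y + ip x z.
Proof. exact: linearDr. Qed.

Lemma ipZr a x y : ip x (a *: y) = a * ip x y.
Proof. exact: linearZr_LR. Qed.

Lemma ip0l x : ip 0 x = 0.
Proof. exact: linear0l. Qed.

Lemma ipNl x y : ip (- x) y = - ip x y.
Proof. exact: linearNl. Qed.

Lemma ipNr x y : ip x (- y) = - ip x y.
Proof. exact: linearNr. Qed.

Lemma ipBl x y z : ip (x - y) z = ip x z - ip y z.
Proof. exact: linearBl. Qed.

Lemma ip_ext x y : (forall z, ip z x = ip z y) -> x = y.
Proof.
move=> xy; apply/eqP; rewrite -subr_eq0 -normr_eq0 -sqrf_eq0 -ip_norm.
by rewrite ipDr ipNr xy subrr.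
Qed.

Lemma CauchySchwarz x y : `|ip x y| <= `|x| * `|y|.
Proof.
rewrite -(@ler_pXn2r _ 2) ?nnegrE ?mulr_ge0// exprMn real_normK ?num_real//.
have [->|y0] := eqVneq y 0.
  by rewrite ipC ip0l normr0 expr0n mulr0.
have y2 : 0 < `|y| ^+ 2 by rewrite exprn_gt0 ?normr_gt0.
(* This vector is orthogonal to [y]; its squared norm is [|y|^2 (|x|^2 |y|^2 - <x,y>^2)]. *)
have : 0 <= ip (`|y| ^+ 2 *: x - ip x y *: y) (`|y| ^+ 2 *: x - ip x y *: y).
  by rewrite ip_norm exprn_ge0.
rewrite ipDl ipDr [X in _ + X]ipDr !ipNl !ipNr !ipZl !ipZr -!ip_norm (ipC y x) !ip_norm.
set p := `|y| ^+ 2 in y2 *; set q := `|x| ^+ 2; set r := ip x y.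
have -> : p * (p * q) + - (p * (r * r)) + (- (r * (p * r)) + - - (r * (r * p)))
  = p * (p * q - r ^+ 2) by ring.
by rewrite pmulr_rge0// subr_ge0 mulrC.
Qed.

Lemma ip_cvg (T : Type) (F : set_system T) {FF : Filter F} (u : T -> H) x w :
  u t @[t --> F] --> x -> ip (u t) w @[t --> F] --> ip x w.
Proof.
move=> /cvgrPdist_le ux; apply/cvgrPdist_le => eps eps0.
have w0 : 0 < `|w| + 1 by rewrite ltr_wpDl.
near=> t; rewrite -ipBl (le_trans (CauchySchwarz _ _))//.
rewrite (@le_trans _ _ (`|x - u t| * (`|w| + 1)))// ?ler_wpM2l ?lerDl//.
rewrite -ler_pdivlMr//; near: t; apply: ux; exact: divr_gt0.
Unshelve. all: by end_near. Qed.

Lemma ip_continuous w : continuous (ip^~ w).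
Proof. by move=> x; apply: ip_cvg. Qed.

Lemma norm_comb2 e1 e2 a b : `|e1| = 1 -> `|e2| = 1 -> ip e1 e2 = 0 ->
  `|a *: e1 + b *: e2| ^+ 2 = a ^+ 2 + b ^+ 2.
Proof.
move=> e11 e21 e12; rewrite -ip_norm ipDl ipDr [X in _ + X]ipDr !ipZl !ipZr.
by rewrite (ipC e2 e1) e12 !ip_norm e11 e21; ring.
Qed.

(** Gram-Schmidt; linear independence keeps both vectors nonzero before they are normalized. *)
Lemma orthonormal_pair : dim_ge2 H ->
  exists e1 e2, [/\ `|e1| = 1, `|e2| = 1 & ip e1 e2 = 0].
Proof.
move=> [x [y xy]].
have unit z : z != 0 -> `| `|z|^-1 *: z| = 1.
  by move=> z0; rewrite normrZ normrV ?unitfE ?normr_eq0// normr_id mulVf ?normr_eq0.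
have x0 : x != 0.
  apply/eqP => x0; have [] := xy 1 0; first by rewrite x0 scaler0 scale0r addr0.
  by move=> /eqP; rewrite oner_eq0.
pose e := `|x|^-1 *: x; pose z := y - ip y e *: e.
have z0 : z != 0.
  apply/eqP => z0; have [] := xy (- (ip y e * `|x|^-1)) 1.
    by rewrite scale1r addrC scaleNr -scalerA.
  by move=> _ /eqP; rewrite oner_eq0.
exists (`|z|^-1 *: z), e; split; rewrite ?unit//.
by rewrite ipZl ipBl ipZl ip_norm unit// expr1n mulr1 subrr mulr0.
Qed.

Section spectral_operator.
Variable e : H.
Hypothesis e1 : `|e| = 1.

(* Acts as [b] on the line spanned by [e] and as [a] on its orthogonal
   complement. *)
Definition spectral_op a b : operator H :=
  Operator setT (fun x => a *: x + ((b - a) * ip x e) *: e).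

Lemma ip_spectral_op a b x y :
  ip (spectral_op a b x) y = a * ip x y + (b - a) * ip x e * ip y e.
Proof. by rewrite ipDl !ipZl (ipC e y). Qed.

Lemma spectral_op_sym a b x y :
  ip (spectral_op a b x) y = ip x (spectral_op a b y).
Proof.
by rewrite ip_spectral_op (ipC x (_ y)) ip_spectral_op (ipC y x); ring.
Qed.

Lemma spectral_op_linear a b : linear_op (spectral_op a b).
Proof.
split=> // c x y _ _; split=> //=.
rewrite ipDl ipZl !scalerDr !scalerA [RHS]addrACA mulrDr scalerDl.
by congr (_ *: _ + _ + (_ *: _ + _)); ring.
Qed.

(** Symmetry and full domain suffice: a pair [(v, w)] in the adjoint graph satisfies
    [<x, T v> = <x, w>] for every [x], so [T v = w]. *)
Lemma spectral_op_self_adjoint a b : self_adjoint ip (spectral_op a b).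
Proof.
split.
- exact: spectral_op_linear.
- by move=> O [x Ox] _; exists x.
- move=> v w; split=> [adj|[_ <-] x _]; last exact: spectral_op_sym.
  by split=> //; apply: ip_ext => x; rewrite -spectral_op_sym adj.
Qed.

Lemma ip_unit_le x : ip x e ^+ 2 <= `|x| ^+ 2.
Proof.
rewrite -real_normK ?num_real// ler_pXn2r ?nnegrE//.
by rewrite (le_trans (CauchySchwarz _ _))// e1 mulr1.
Qed.

Lemma spectral_op_ge a b x : Num.min a b * `|x| ^+ 2 <= ip (spectral_op a b x) x.
Proof.
rewrite ip_spectral_op ip_norm; have := ip_unit_le x.
set q := `|x| ^+ 2; set p := ip x e => pq; have p0 : 0 <= p ^+ 2 by exact: sqr_ge0.
have [ab|ab] := leP a b; nra.
Qed.

Lemma spectral_op_coercive a b : 0 < a -> 0 < b -> coercive ip (spectral_op a b).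
Proof.
move=> a0 b0; exists (Num.min a b) => [|x _]; last exact: spectral_op_ge.
by rewrite lt_min a0.
Qed.

Lemma spectral_op_comp a b a' b' x :
  spectral_op a b (spectral_op a' b' x) = spectral_op (a * a') (b * b') x.
Proof.
rewrite /= ipDl !ipZl ip_norm e1 expr1n mulr1 scalerDr !scalerA -addrA -scalerDl.
by congr (_ + _ *: _); ring.
Qed.

Lemma spectral_op_sqrt a b : 0 <= a -> 0 <= b ->
  is_sqrt_op ip (spectral_op (a ^+ 2) (b ^+ 2)) (spectral_op a b).
Proof.
move=> a0 b0; split=> //.
- exact: spectral_op_self_adjoint.
- move=> x _; apply: le_trans (spectral_op_ge _ _ _).
  by rewrite mulr_ge0// ?exprn_ge0// le_min a0.
- by move=> x _; rewrite spectral_op_comp.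
Qed.

Lemma spectral_op_sub_pos l a b : l < a -> l < b ->
  positive_op ip (op_sub (spectral_op a b) (spectral_op l l)).
Proof.
move=> la lb x _ x0.
have -> : op_sub (spectral_op a b) (spectral_op l l) x = spectral_op (a - l) (b - l) x.
  rewrite /= subrr mul0r scale0r addr0 addrAC -scalerBl.
  by congr (_ + _ *: _); ring.
apply: lt_le_trans (spectral_op_ge _ _ _).
by rewrite mulr_gt0// ?exprn_gt0 ?normr_gt0// lt_min !subr_gt0 la.
Qed.

End spectral_operator.
End inner_product.

(** * Decay and integration on the real line *)

Section real_lemmas.
Context (R : realType).
Local Notation mu := (@lebesgue_measure R).

(* Above the level [M] the function loses at least [k] per unit of time, so it
   drops below [M] after a time controlled by its initial value and never
   comes back. *)
Lemma decay_to_level (z : R -> R) (T M k : R) :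
    0 <= k ->
    (forall t, T <= t -> {for t, continuous z}) ->
    (forall s t, T <= s -> s < t -> (forall x, s < x -> x <= t -> M < z x) ->
      z t <= z s - k * (t - s)) ->
  forall t, T <= t -> z t <= M \/ z t <= z T - k * (t - T).
Proof.
move=> k0 cz dz t Tt; have [|Mzt] := leP (z t) M; [by left|right].
have [->|neTt] := eqVneq t T; first by rewrite subrr mulr0 subr0.
have {neTt}Tt' : T < t by rewrite lt_neqAle eq_sym neTt.
pose S := [set x | [/\ T <= x, x <= t & z x <= M]].
(* If [z] stays above [M] on [[T, t]], it decays all along; otherwise the last time [s] with
   [z s <= M] leads to a contradiction. *)
have [S0|/set0P S0] := eqVneq S set0.
  apply: dz => // x Tx xt; rewrite ltNge; apply/negP => zx.
  suff : set0 x by []. by rewrite -S0; split=> //; exact: ltW.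
have supS : has_sup S by split=> //; exists t => x [].
pose s := sup S.
have ubS x : S x -> x <= s := @sup_upper_bound _ _ supS x.
have Ts : T <= s by have [x Sx] := S0; apply: le_trans (ubS _ Sx); case: Sx.
have st : s <= t by apply: ge_sup => // x [].
(* By continuity, [z s > M] would persist just to the left of [s], where the supremum finds points
   of [S]. *)
have zs : z s <= M.
  rewrite leNgt; apply/negP => Mzs.
  have [eps /= eps0 Heps] : \forall x \near s, M < z x.
    by have := cz s Ts; move=> /cvgr_gt; apply.
  have [x Sx sx] := sup_adherent eps0 supS.
  have xs : x <= s := ubS _ Sx.
  have [_ _] := Sx; rewrite leNgt => /negP; apply; apply: Heps.
  by rewrite /= ger0_norm ?subr_ge0// ltrBlDr addrC -ltrBlDr.
have {}st : s < t by rewrite lt_neqAle st andbT; apply: contraTneq Mzt => <-; rewrite -leNgt.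
have := dz s t Ts st.
have Mx x : s < x -> x <= t -> M < z x.
  move=> sx xt; rewrite ltNge; apply/negP => zx.
  suff : x <= s by rewrite leNgt sx.
  by apply: ubS; split=> //; exact: le_trans (ltW sx).
move=> /(_ Mx) zt; have := le_lt_trans zs (lt_le_trans Mzt zt).
by rewrite ltrDl oppr_gt0 ltNge mulr_ge0// subr_ge0 ltW.
Qed.

Lemma ae_bounded_Rintegral_le (g : R -> R) (s t F : R) : 0 <= F -> s < t ->
    mu.-integrable `]s, t] (EFin \o g) ->
    {ae mu, forall x, s < x -> `|g x| <= F} ->
  \int[mu]_(x in `]s, t]) g x <= F * (t - s).
Proof.
move=> F0 st ig [N [mN N0 sN]].
apply: (le_trans (ler_norm _)).
apply: (le_trans (@le_normr_Rintegral _ _ _ mu _ g (measurable_itv _) ig)).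
have iabs := integrable_abse ig.
rewrite -lee_fin /Rintegral fineK; last first.
  by apply: integrable_fin_num => //; exact: iabs.
have := @ae_ge0_le_integral _ _ _ mu _ (measurable_itv `]s, t])
  (abse \o (EFin \o g)) (cst F%:E).
rewrite integral_cst//= lebesgue_measure_itv/= lte_fin st; apply.
- by move=> x _; rewrite lee_fin.
- by have := measurable_int _ iabs.
- by move=> x _; rewrite lee_fin.
- by [].
- exists N; split=> // x /= xN; apply: sN => /= gx; apply: xN => stx.
  by rewrite lee_fin gx//; move: stx; rewrite /= in_itv => /andP[].
Qed.

End real_lemmas.

Section integrals.
Context (R : realType).
Local Notation mu := (@lebesgue_measure R).

Lemma continuous_integrable (f : R -> R) (s t : R) :
    (forall x, s <= x -> x <= t -> {for x, continuous f}) ->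
  mu.-integrable `]s, t] (EFin \o f).
Proof.
move=> cf; apply: (@integrableS _ _ _ mu `[s, t]) => //.
  by apply: subset_itvr; rewrite bnd_simp.
apply: continuous_compact_integrable; first exact: segment_compact.
apply/subspace_continuousP => x /=; rewrite in_itv/= => /andP[sx xt].
by apply: cvg_within_filter; exact: cf.
Qed.

Lemma Rintegral_FTC2 (f F : R -> R) (s t : R) : s < t ->
    (forall x, s <= x -> x <= t -> is_derive x 1 F (f x)) ->
    (forall x, s <= x -> x <= t -> {for x, continuous f}) ->
  \int[mu]_(x in `]s, t]) f x = F t - F s.
Proof.
move=> st dF cf.
have cF x : s <= x -> x <= t -> {for x, continuous F}.
  by move=> sx xt; apply/differentiable_continuous/derivable1_diffP; case: (dF x sx xt).
rewrite Rintegral_itv_obnd_cbnd; last exact: continuous_integrable.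
rewrite /Rintegral (@continuous_FTC2 _ f F)//.
- apply/subspace_continuousP => x /=; rewrite in_itv/= => /andP[sx xt].
  by apply: cvg_within_filter; exact: cf.
- split.
  + by move=> x; rewrite in_itv/= => /andP[/ltW sx /ltW xt]; case: (dF x sx xt).
  + by apply: cvg_at_right_filter; apply: cF => //; exact: ltW.
  + by apply: cvg_at_left_filter; apply: cF => //; exact: ltW.
- move=> x; rewrite in_itv/= => /andP[/ltW sx /ltW xt].
  by rewrite derive1E; have := dF x sx xt => dFx; rewrite derive_val.
Qed.

(** * Measurability and integrability of scalar components *)

Section strong_measurability.
Context (H : completeNormedModType R) (ip : {dot H for idfun}).
Hypothesis ip_norm : inner_product_of_norm ip.

(** For a simple function the preimage is a finite union of measurable fibres; measurability passes
    to the pointwise limit by continuity of [phi]. *)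
Lemma strongly_measurable_comp (D : set R) (f : R -> H) (phi : H -> R) :
    continuous phi -> strongly_measurable D f ->
  measurable_fun (D : set (g_sigma_algebraType R.-ocitv.-measurable)) (phi \o f).
Proof.
move=> cphi [s [ss sf]].
apply: (@measurable_fun_cvg _ _ _ _ (fun n => phi \o s n)).
  move=> n; apply: measurable_funTS => _ Y mY; rewrite setTI.
  have [fin ms] := ss n.
  rewrite (_ : _ @^-1` Y = \bigcup_(x in range (s n) `&` phi @^-1` Y) (s n @^-1` [set x])).
    apply: fin_bigcup_measurable => //; exact: finite_setIl.
  apply/seteqP; split=> [t /= Yt|t [x [_ Yx] /= sx]]; last by rewrite /= sx.
  by exists (s n t) => //; split=> //; exists t.
by move=> t Dt; apply: continuous_cvg; [exact: cphi|exact: sf].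
Qed.

Lemma bochner_integrable_ip (D : set R) (f : R -> H) (w : H) :
    measurable (D : set (g_sigma_algebraType R.-ocitv.-measurable)) ->
  bochner_integrable D f -> mu.-integrable D (EFin \o (fun t => ip (f t) w)).
Proof.
move=> mD [smf intf].
have iN : mu.-integrable D (EFin \o (fun t => `|f t|)).
  apply/integrableP; split.
    apply/measurable_EFinP; apply: (@strongly_measurable_comp _ _ (fun x => `|x|)) => //.
    exact: norm_continuous.
  by under eq_integral do rewrite /= normr_id.
apply: (le_integrable _ _ _ (integrableZl mD `|w| iN)) => //.
  apply/measurable_EFinP; apply: (@strongly_measurable_comp _ _ (ip^~ w)) => //.
  exact: ip_continuous.
move=> t _ /=; rewrite lee_fin mulrC [leRHS]ger0_norm ?mulr_ge0//.
exact: CauchySchwarz.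
Qed.

End strong_measurability.
End integrals.

(** * Essential and pointwise limsup *)

Section limsup.
Context (R : realType) (H : completeNormedModType R).
Local Notation mu := (@lebesgue_measure R).
Implicit Types (f v : R -> H).

(** Null sets are cut down to []T, +oo[] in one direction and, in the other, enlarged by its
    complement, which is null for the restricted measure. *)
Lemma Loo_norm_afterE f T :
  Loo_norm_after f T = ereal_inf [set y | {ae mu, forall t, T < t -> (`|f t|%:E <= y)%E}].
Proof.
rewrite /Loo_norm_after unlock /= /mrestr setTI lebesgue_measure_itv/= ltry addye//= lt0y.
rewrite ess_supEae; congr (ereal_inf _); apply/seteqP; split=> y /=.
  move=> [N [mN N0 sN]]; exists (N `&` `]T, +oo[); split.
  - exact: measurableI.
  - exact: N0.
  - move=> t /= /not_implyP[Tt ft]; split; last by rewrite /= in_itv/= andbT.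
    by apply: sN => /=; rewrite normr_id.
move=> [N [mN N0 sN]]; exists (N `|` ~` `]T, +oo[); split.
- by apply: measurableU => //; apply: measurableC.
- rewrite /mrestr setIUl setICl setU0; apply/eqP; rewrite -measure_le0 -[leRHS]N0.
  by apply: le_measure; rewrite ?inE//; exact: measurableI.
- move=> t /= ft; have [Tt|Tt] := pselect (t \in `]T, +oo[); [left|by right].
  apply: sN => /= ftT; apply: ft; rewrite normr_id; apply: ftT.
  by move: Tt; rewrite in_itv/= andbT.
Qed.

Lemma ess_limsup_normE f : ess_limsup_norm f = ereal_inf (range (Loo_norm_after f)).
Proof.
apply: cvg_lim => //; apply: nonincreasing_cvge => S T ST.
rewrite !Loo_norm_afterE; apply: ereal_inf_le_tmp => y /= [N [mN N0 sN]].
exists N; split=> // t /= ft; apply: sN => /= fy; apply: ft => Tt; apply: fy; exact: le_lt_trans Tt.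
Qed.

Lemma ess_limsup_norm_ge0 f : (0 <= ess_limsup_norm f)%E.
Proof.
by rewrite ess_limsup_normE; apply: le_ereal_inf_tmp => _ [T _ <-]; exact: Lnorm_ge0.
Qed.

Lemma ess_limsup_norm_eventually f : (ess_limsup_norm f < +oo)%E ->
  exists2 L, 0 <= L & ess_limsup_norm f = L%:E /\
    forall eps, 0 < eps ->
      exists2 T, 0 < T & {ae mu, forall t, T < t -> `|f t| <= L + eps}.
Proof.
have := ess_limsup_norm_ge0 f; case E : (ess_limsup_norm f) => [L| |]//.
rewrite lee_fin => L0 _; exists L => //; split=> // eps eps0.
have : (ereal_inf (range (Loo_norm_after f)) < (L + eps)%:E)%E.
  by rewrite -ess_limsup_normE E lte_fin ltrDl.
move=> /ereal_inf_lt[_ [T _ <-]]; rewrite Loo_norm_afterE => /ereal_inf_lt[y /= fy yL].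
exists (Num.max T 1); first by rewrite lt_max ltr01 orbT.
move: fy => [N [mN N0 sN]]; exists N; split=> // t /= ft; apply: sN => /= fy.
apply: ft; rewrite gt_max => /andP[Tt _].
by rewrite -lee_fin (le_trans (fy Tt))// ltW.
Qed.

Lemma ess_limsup_norm_le f M : (forall t, 0 < t -> `|f t| <= M) ->
  (ess_limsup_norm f <= M%:E)%E.
Proof.
move=> fM; rewrite ess_limsup_normE; apply: ge_ereal_inf; exists (Loo_norm_after f 0); first by exists 0.
rewrite Loo_norm_afterE; apply: ereal_inf_lbound => /=.
by exists set0; split=> // t /= ft; apply: ft => t0; rewrite lee_fin fM.
Qed.

Lemma limsup_norm_le v M :
    (forall eps, 0 < eps -> exists T, forall t, T <= t -> `|v t| <= M + eps) ->
  (limsup_norm v <= M%:E)%E.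
Proof.
move=> vM; apply/lee_addgt0Pr => eps /vM[T vT]; rewrite /limsup_norm limf_esupE.
apply: ge_ereal_inf.
exists (ereal_sup ((fun t => `|v t|%:E) @` [set t | T <= t])).
  by exists [set t | T <= t] => //; exact/nbhs_pinfty_ge/num_real.
by apply: ge_ereal_sup => _ [t /= Tt <-]; rewrite -EFinD lee_fin vT.
Qed.

Lemma limsup_norm_ge v M :
  (forall T, exists2 t, T < t & M <= `|v t|) -> (M%:E <= limsup_norm v)%E.
Proof.
move=> vM; rewrite /limsup_norm limf_esupE; apply: le_ereal_inf_tmp => _ [V [T [_ TV]] <-].
have [t Tt vt] := vM T; apply: (@le_trans _ _ (`|v t|)%:E); first by rewrite lee_fin.
by apply: ereal_sup_ubound; exists t => //; exact: TV.
Qed.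

End limsup.

(** * Upper bounds on the velocity *)

Section difference_quotient.
Context (R : realType).

(** Passes from the difference quotient in an increment [h -> 0] to the one in [s -> t], the form
    used in [derivative_on_nonneg]. *)
Lemma is_derive1_quotientP (g : R -> R) (t l : R) :
  is_derive t 1 g l <-> (s - t)^-1 * (g s - g t) @[s --> t^'] --> l.
Proof.
have from_t : (fun s => s - t) @ t^' --> (0 : R)^'.
  move=> P [e /= e0 eP]; exists e => // s /= st st0; apply: eP => /=.
    by rewrite sub0r opprB.
  by rewrite subr_eq0.
have to_t : (fun h => h + t) @ (0 : R)^' --> t^'.
  move=> P [e /= e0 eP]; exists e => // s /=; rewrite sub0r => st st0; apply: eP => /=.
    by rewrite opprD addrCA subrr addr0.
  by rewrite -subr_eq0 addrK.
have quotE : (fun h => h^-1 *: ((g \o shift t) (h *: 1) - g t)) =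
    (fun s => (s - t)^-1 * (g s - g t)) \o (fun h => h + t).
  by apply/funext => h /=; rewrite addrK (_ : h *: 1 = h)//; exact: mulr1.
split=> [[/cvg_ex[/= l' dg] gl]|dg].
  have {gl}<- : l' = l by rewrite -gl; apply/esym/cvg_lim.
  have := cvg_comp _ _ from_t dg; rewrite quotE.
  by under [X in X @ _]eq_fun do rewrite /= subrK.
have dg0 := cvg_comp _ _ to_t dg.
apply: DeriveDef; rewrite /derivable/derive quotE; last exact: cvg_lim.
by apply/cvg_ex; exists l.
Qed.

Lemma is_derive_continuous (g dg : R -> R) :
  (forall t : R, is_derive t 1 g (dg t)) -> continuous g.
Proof.
by move=> gP t; apply/differentiable_continuous/derivable1_diffP; case: (gP t).
Qed.

End difference_quotient.

Section weak_solution_bounds.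
Context (R : realType) (H : completeNormedModType R) (ip : {dot H for idfun}).
Hypothesis ip_norm : inner_product_of_norm ip.
Local Notation mu := (@lebesgue_measure R).
Implicit Types (A : operator H) (f u v : R -> H) (w : H).

Lemma within_nonneg_continuous (g : R -> H) w :
    {within `[0, +oo[, continuous g} ->
  forall t : R, 0 < t -> {for t, continuous (fun s => ip (g s) w)}.
Proof.
move=> /continuous_within_itvcyP[cg _] t t0.
by apply: (ip_cvg ip_norm); apply: cg; rewrite in_itv/= t0.
Qed.

Lemma within_nonneg_integrable (g : R -> H) w (t : R) :
    {within `[0, +oo[, continuous g} ->
  mu.-integrable `]0, t] (EFin \o (fun s => ip (g s) w)).
Proof.
move=> /subspace_continuousP cg.
apply: (@integrableS _ _ _ mu `[0, t]) => //.
  by apply: subset_itvr; rewrite bnd_simp.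
apply: continuous_compact_integrable; first exact: segment_compact.
apply/subspace_continuousP => x /=; rewrite in_itv/= => /andP[x0 xt].
apply: (ip_cvg ip_norm); apply: cvg_trans (cg x _); last by rewrite /= in_itv/= x0.
apply: cvg_app; apply: within_subset => s /=; rewrite !in_itv/= => /andP[->//].
Qed.

Lemma integrable_EFinB (i : interval R) (g h : R -> R) :
    mu.-integrable [set` i] (EFin \o g) -> mu.-integrable [set` i] (EFin \o h) ->
  mu.-integrable [set` i] (EFin \o (fun x => g x - h x)).
Proof.
by move=> ig ih; have := @integrableB _ _ _ mu _ (measurable_itv i) _ _ ig ih; exact: eq_integrable.
Qed.

Lemma integrable_EFinZ (i : interval R) (k : R) (g : R -> R) :
    mu.-integrable [set` i] (EFin \o g) ->
  mu.-integrable [set` i] (EFin \o (fun x => k * g x)).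
Proof.
by move=> ig; have := @integrableZl _ _ _ mu _ (measurable_itv i) k _ ig; exact: eq_integrable.
Qed.

Lemma ip_is_derive u v w : derivative_on_nonneg u v ->
  forall t : R, 0 < t -> is_derive t 1 (fun s => ip (u s) w) (ip (v t) w).
Proof.
move=> duv t t0; apply/is_derive1_quotientP.
have : (s - t)^-1 *: (u s - u t) @[s --> t^'] --> v t.
  have := duv t (ltW t0); apply: cvg_trans; apply: cvg_app.
  (* Near a positive time all times are positive, so the derivative relative to [[0, +oo[] is
     two-sided there. *)
  have pos : \forall s \near t, 0 < s by apply: lt_nbhsr.
  move=> P PW; rewrite /dnbhs/within/=; apply: filterS2 pos PW => s s0 Ps st.
  by apply: Ps; split=> //; exact: ltW.
move=> dt; have : ip ((s - t)^-1 *: (u s - u t)) w @[s --> t^'] --> ip (v t) w.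
  exact: (ip_cvg ip_norm).
apply: cvg_trans; apply: near_eq_cvg.
by near=> s; rewrite ipZl ipBl.
Unshelve. all: by end_near. Qed.

(** Testing against an eigenvector gives a scalar equation: [B] is symmetric with square [A], hence
    [<B u, B w> = <A u, w> = l <u, w>]. *)
Lemma weak_solution_increment A (c l : R) f u v w :
    opdom A = setT -> (forall x, ip (A x) w = l * ip x w) ->
    (forall T, 0 < T -> bochner_integrable `]0, T[ f) ->
    weak_solution ip A c f u v ->
  forall s t : R, 0 < s -> s < t ->
    mu.-integrable `]s, t] (EFin \o (fun x => ip (f x) w)) /\
    ip (v t) w - ip (v s) w =
      \int[mu]_(x in `]s, t]) (ip (f x) w - c * ip (v x) w - l * ip (u x) w).
Proof.
move=> domA Aw intf [B [[_ _ adjB] _ domB AB] [_ cu _ [_ cv] eqn]] s t s0 st.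
have domB' x : opdom B x by have [] := (domB x).1; rewrite ?domA.
have Bw x : ip (B x) (B w) = l * ip x w.
  have symB : adjoint_graph ip B w (B w) by apply/adjB.
  by rewrite -symB// -AB ?domA// Aw.
pose I x := ip (f x) w - c * ip (v x) w - l * ip (u x) w.
have iF (T : R) : 0 < T -> mu.-integrable `]0, T] (EFin \o (fun x => ip (f x) w)).
  (* Integrability is given on open intervals; []0, T + 1[] covers the endpoint [T]. *)
  move=> T0; apply: (@integrableS _ _ _ mu `]0, T + 1[) => //.
    by apply: subset_itvl; rewrite bnd_simp ltrDl.
  by apply: (bochner_integrable_ip ip_norm) => //; apply: intf; exact: addr_gt0.
have iI (T : R) : 0 < T -> mu.-integrable `]0, T] (EFin \o I).
  move=> T0; apply: integrable_EFinB; last first.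
    by apply: integrable_EFinZ; exact: within_nonneg_integrable.
  apply: integrable_EFinB; first exact: iF.
  by apply: integrable_EFinZ; exact: within_nonneg_integrable.
have vE (T : R) : 0 < T -> ip (v T) w = ip (v 0) w + \int[mu]_(x in `]0, T]) I x.
  move=> T0; rewrite (eqn w T)//; last exact: ltW.
  rewrite -Rintegral_itv_bndo_bndc; last first.
    apply: (@integrableS _ _ _ mu `]0, T]) => //; last exact: iI.
    by apply: subset_itvl; rewrite bnd_simp.
  by congr (_ + _); apply: eq_Rintegral => x _; rewrite Bw.
have t0 : 0 < t := lt_trans s0 st.
split.
  apply: (@integrableS _ _ _ mu `]0, t]) => //; last exact: iF.
  by apply: subset_itvr; rewrite bnd_simp ltW.
rewrite (vE t t0) (vE s s0) opprD addrACA subrr add0r.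
by rewrite (@Rintegral_itvB _ I (BRight 0) (BRight t) s) ?bnd_simp ?ltW//; exact: iI.
Qed.

End weak_solution_bounds.

(** * Factorization into two first order equations *)

Section velocity_bounds.
Context (R : realType) (H : completeNormedModType R) (ip : {dot H for idfun}).
Hypothesis ip_norm : inner_product_of_norm ip.
Local Notation mu := (@lebesgue_measure R).
Implicit Types (A : operator H) (f u v : R -> H) (w : H).

Definition unit_eigenvector A (l : R) w :=
  `|w| = 1 /\ forall x, ip (A x) w = l * ip x w.

Lemma unit_eigenvectorN A l w : unit_eigenvector A l w -> unit_eigenvector A l (- w).
Proof.
by move=> [w1 Aw]; split=> [|x]; rewrite ?normrN// !ipNr Aw mulrN.
Qed.

(** Integrated form of [z' + r2 z = f] for [z = u' + r1 u]: the equation gives [z' = f - (r1 + r2)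
    u' - r1 r2 u + r1 u' = f - r2 z]. *)
Lemma weak_solution_factor_increment A (r1 r2 : R) f u v w :
    opdom A = setT -> unit_eigenvector A (r1 * r2) w ->
    (forall T, 0 < T -> bochner_integrable `]0, T[ f) ->
    weak_solution ip A (r1 + r2) f u v ->
  forall s t : R, 0 < s -> s < t ->
    ip (v t + r1 *: u t) w - ip (v s + r1 *: u s) w =
      \int[mu]_(x in `]s, t]) ip (f x) w -
      r2 * \int[mu]_(x in `]s, t]) ip (v x + r1 *: u x) w.
Proof.
move=> domA [_ Aw] intf sol s t s0 st.
have [intfw incr] := weak_solution_increment ip_norm domA Aw intf sol s0 st.
have [B _ [_ cu _ [duv cv] _]] := sol.
have cu' x : s <= x -> x <= t -> {for x, continuous (fun y => ip (u y) w)}.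
  by move=> sx _; apply: (within_nonneg_continuous ip_norm) => //; exact: lt_le_trans sx.
have cv' x : s <= x -> x <= t -> {for x, continuous (fun y => ip (v y) w)}.
  by move=> sx _; apply: (within_nonneg_continuous ip_norm) => //; exact: lt_le_trans sx.
have iu := continuous_integrable cu'; have iv := continuous_integrable cv'.
have du : \int[mu]_(x in `]s, t]) ip (v x) w = ip (u t) w - ip (u s) w.
  apply: (@Rintegral_FTC2 _ (fun x => ip (v x) w) (fun x => ip (u x) w)) => // x sx _.
  by apply: (ip_is_derive ip_norm) => //; exact: lt_le_trans sx.
have -> : \int[mu]_(x in `]s, t]) ip (v x + r1 *: u x) w =
    \int[mu]_(x in `]s, t]) ip (v x) w + r1 * \int[mu]_(x in `]s, t]) ip (u x) w.
  under eq_Rintegral do rewrite ipDl ipZl.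
  rewrite RintegralD//; last exact: integrable_EFinZ.
  by rewrite RintegralZl.
rewrite !RintegralB// in incr; do ?[apply: integrable_EFinB|apply: integrable_EFinZ] => //.
rewrite !RintegralZl// in incr.
rewrite !ipDl !ipZl opprD addrACA incr -mulrBr -du; ring.
Qed.

(* With roots [r1], [r2] of [X^2 - c X + l], the equation factors as
   [u' + r1 u = z], [z' + r2 z = f]; hence asymptotically [|z| <= F / r2],
   [|u| <= F / (r1 r2)] and [|u'| <= |z| + r1 |u|]. *)
Lemma eigencomponent_bound A (r1 r2 F T0 : R) f u v :
    0 < r1 -> 0 < r2 -> 0 <= F -> 0 < T0 ->
    opdom A = setT ->
    (forall T, 0 < T -> bochner_integrable `]0, T[ f) ->
    weak_solution ip A (r1 + r2) f u v ->
    {ae mu, forall t, T0 < t -> `|f t| <= F} ->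
  forall eps, 0 < eps ->
    exists T, forall t, T <= t -> forall w, unit_eigenvector A (r1 * r2) w ->
      ip (v t) w <= 2 * F / r2 + eps.
Proof.
move=> r10 r20 F0 T00 domA intf sol fF eps eps0.
have [B _ [_ cu _ [duv cv] _]] := sol.
(* The slack accumulates to [2 d + r1 d = eps] in the final sum [M + r1 * M2]. *)
pose d := eps / (2 + r1).
have d0 : 0 < d by rewrite divr_gt0// addr_gt0.
pose M := F / r2 + d.
have M0 : 0 <= M by apply: addr_ge0; [apply: divr_ge0 => //|]; exact: ltW.
(* Losing [r2 * d] per unit of time, [z] uses up its initial value by [T1]. Bounding that value by a
   norm makes [T1] independent of [w]. *)
pose T1 := T0 + `|v T0 + r1 *: u T0| / (r2 * d).
have T01 : T0 <= T1 by rewrite lerDl divr_ge0// mulr_ge0 ?ltW.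
have zM w t : unit_eigenvector A (r1 * r2) w -> T1 <= t -> ip (v t + r1 *: u t) w <= M.
  move=> Ew T1t; have T0t := le_trans T01 T1t.
  pose z x := ip (v x + r1 *: u x) w.
  have cz x : T0 <= x -> {for x, continuous z}.
    move=> T0x; have x0 := lt_le_trans T00 T0x.
    have -> : z = (fun x => ip (v x) w) \+ (fun x => r1 * ip (u x) w).
      by apply/funext => y; rewrite /z ipDl ipZl.
    have cvx := within_nonneg_continuous (w := w) ip_norm cv x0.
    have cux := within_nonneg_continuous (w := w) ip_norm cu x0.
    by apply: cvgD; [exact: cvx|apply: cvgMr; exact: cux].
  have k0 : 0 <= r2 * d by rewrite mulr_ge0 ?ltW.
  have dz a b : T0 <= a -> a < b -> (forall x, a < x -> x <= b -> M < z x) ->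
      z b <= z a - r2 * d * (b - a).
    move=> T0a ab zab; have a0 := lt_le_trans T00 T0a.
    have [intfw _] := weak_solution_increment ip_norm domA Ew.2 intf sol a0 ab.
    have := weak_solution_factor_increment domA Ew intf sol a0 ab; rewrite -/(z a) -/(z b).
    have fI : \int[mu]_(x in `]a, b]) ip (f x) w <= F * (b - a).
      apply: ae_bounded_Rintegral_le => //.
      move: fF => [N [mN N0 sN]]; exists N; split=> // x /= fx; apply: sN => /= fxF.
      apply: fx => ax; rewrite (le_trans (CauchySchwarz ip_norm _ _))// Ew.1 mulr1.
      by apply: fxF; exact: le_lt_trans ax.
    have zI : M * (b - a) <= \int[mu]_(x in `]a, b]) z x.
      have iz : mu.-integrable `]a, b] (EFin \o z).
        by apply: continuous_integrable => x ax _; apply: cz; exact: le_trans ax.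
      have iM : mu.-integrable `]a, b] (EFin \o cst M).
        by apply: continuous_integrable => x _ _; exact: cst_continuous.
      have -> : M * (b - a) = \int[mu]_(x in `]a, b]) cst M x.
        by rewrite Rintegral_cst//= lebesgue_measure_itv/= lte_fin ab.
      apply: le_Rintegral => // x; rewrite /= in_itv/= => /andP[ax xb].
      exact/ltW/zab.
    (* Above the level [M = F / r2 + d] the damping exceeds the forcing by at least this rate. *)
    have -> : r2 * d = r2 * M - F by rewrite /M; field; rewrite gt_eqF.
    move: fI zI; set J := Rintegral _ _ _; set K := Rintegral _ _ _ => fI zI.
    by have := ler_wpM2l (ltW r20) zI; lra.
  have [//|zt] := decay_to_level k0 cz dz T0t.
  apply: le_trans zt _; rewrite lerBlDr.
  apply: (@le_trans _ _ `|v T0 + r1 *: u T0|).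
    apply: le_trans (ler_norm _) _.
    by rewrite (le_trans (CauchySchwarz ip_norm _ _))// Ew.1 mulr1.
    apply: ler_wpDl => //.
    rewrite [leRHS]mulrC -ler_pdivrMr; last exact: mulr_gt0.
    by rewrite lerBrDl.
(* The same argument for the other factor: [u' = z - r1 u <= M - r1 M2 = - r1 d] as long as [u]
   exceeds [M2]. *)
pose M2 := M / r1 + d; pose T2 := T1 + `|u T1| / (r1 * d).
have T12 : T1 <= T2 by rewrite lerDl divr_ge0// mulr_ge0 ?ltW.
have M20 : 0 <= M2 by apply: addr_ge0; [apply: divr_ge0 => //|]; exact: ltW.
have T10 := lt_le_trans T00 T01.
have yM w t : unit_eigenvector A (r1 * r2) w -> T2 <= t -> ip (u t) w <= M2.
  move=> Ew T2t; have T1t := le_trans T12 T2t.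
  pose y x := ip (u x) w.
  have cy x : T1 <= x -> {for x, continuous y}.
    by move=> T1x; apply: (within_nonneg_continuous ip_norm) => //; exact: lt_le_trans T1x.
  have k0 : 0 <= r1 * d by rewrite mulr_ge0 ?ltW.
  have dy a b : T1 <= a -> a < b -> (forall x, a < x -> x <= b -> M2 < y x) ->
      y b <= y a - r1 * d * (b - a).
    move=> T1a ab yab.
    have [x /[!in_itv]/= /andP[ax xb] yE] : exists2 x, x \in `]a, b[ &
        y b - y a = ip (v x) w * (b - a).
      apply: (@MVT _ y) => // [x|].
        rewrite in_itv/= => /andP[ax _]; apply: (ip_is_derive ip_norm) => //.
        by apply: lt_trans ax; exact: lt_le_trans T1a.
      apply/subspace_continuousP => x /=; rewrite in_itv/= => /andP[ax _].
      by apply: cvg_within_filter; apply: cy; exact: le_trans ax.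
    have x0 : T1 <= x by rewrite (le_trans T1a)// ltW.
    have zx := zM w x Ew x0; have yx := yab x ax (ltW xb).
    rewrite ipDl ipZl -/(y x) in zx.
    have : ip (v x) w <= - (r1 * d).
      have : r1 * M2 <= r1 * y x by rewrite ler_wpM2l// ltW.
      by rewrite /M2 mulrDr mulrCA divff ?gt_eqF// mulr1; lra.
    have ba : 0 <= b - a by rewrite subr_ge0 ltW.
    by move=> /(ler_wpM2r ba); lra.
  have [//|yt] := decay_to_level k0 cy dy T1t.
  apply: le_trans yt _; rewrite lerBlDr.
  apply: (@le_trans _ _ `|u T1|).
    apply: le_trans (ler_norm _) _.
    by rewrite (le_trans (CauchySchwarz ip_norm _ _))// Ew.1 mulr1.
    apply: ler_wpDl => //.
    rewrite [leRHS]mulrC -ler_pdivrMr; last exact: mulr_gt0.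
    by rewrite lerBrDl.
exists T2 => t T2t w Ew.
(* The bound on [u] is used along [- w], because [u' = z - r1 u] is large when [u] is very
   negative. *)
have := zM w t Ew (le_trans T12 T2t); have := yM _ t (unit_eigenvectorN Ew) T2t.
rewrite ipNr ipDl ipZl => yt zt.
have -> : 2 * F / r2 + eps = M + r1 * M2.
  by rewrite /M2 /M /d; field; rewrite ?gt_eqF// addr_gt0.
have := ler_wpM2l (ltW r10) yt; lra.
Qed.

End velocity_bounds.

(** * Bounds for the spectral operators and existence of the optimal constant *)

Section velocity_bound_existence.
Context (R : realType) (H : completeNormedModType R) (ip : {dot H for idfun}).
Hypothesis ip_norm : inner_product_of_norm ip.
Implicit Types (A : operator H) (f u v : R -> H) (w e : H).

Lemma eigencomponent_limsup A (r1 r2 L : R) f u v :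
    0 < r1 -> 0 < r2 -> opdom A = setT ->
    (forall T, 0 < T -> bochner_integrable `]0, T[ f) ->
    ess_limsup_norm f = L%:E ->
    weak_solution ip A (r1 + r2) f u v ->
  forall eps, 0 < eps ->
    exists T, forall t, T <= t -> forall w, unit_eigenvector ip A (r1 * r2) w ->
      ip (v t) w <= 2 / r2 * L + eps.
Proof.
move=> r10 r20 domA intf fL sol eps eps0.
have [|L' L'0 [fL' fev]] := @ess_limsup_norm_eventually _ _ f.
  by rewrite fL ltry.
have LE : L' = L by move: fL'; rewrite fL => -[].
rewrite LE in L'0 fev.
have eps2 : 0 < eps / 2 by rewrite divr_gt0.
have d0 : 0 < eps * r2 / 4 by rewrite divr_gt0// mulr_gt0.
have [T0 T00 fT0] := fev _ d0.
have F0 : 0 <= L + eps * r2 / 4 by rewrite addr_ge0// ltW.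
have [T vT] := eigencomponent_bound ip_norm r10 r20 F0 T00 domA intf sol fT0 eps2.
exists T => t Tt w Ew; apply: le_trans (vT t Tt w Ew) _.
by rewrite le_eqVlt; apply/orP; left; apply/eqP; field; rewrite gt_eqF.
Qed.

(** The overdamped regime: with [q] the root of the discriminant, the smaller root is
    [2 l / (c + q) <= 2 l / c], so the larger one stays close to [c]. *)
Lemma char_poly_roots (c l : R) : 0 < c -> 0 < l -> 4 * l < c ^+ 2 ->
  exists r1 r2, [/\ 0 < r1, 0 < r2, r1 + r2 = c, r1 * r2 = l & c - 2 * l / c <= r2].
Proof.
move=> c0 l0 lc; pose q := Num.sqrt (c ^+ 2 - 4 * l).
have q2 : q ^+ 2 = c ^+ 2 - 4 * l by rewrite sqr_sqrtr// subr_ge0 ltW.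
have q0 : 0 <= q := sqrtr_ge0 _.
have qc : q < c by rewrite -(@ltr_pXn2r _ 2) ?nnegrE ?(ltW c0)// q2; lra.
exists ((c - q) / 2), ((c + q) / 2); split; try lra.
have : (c - q) * c <= 4 * l.
  have -> : 4 * l = (c - q) * (c + q) by rewrite -subr_sqr q2; ring.
  by apply: ler_wpM2l; [rewrite subr_ge0 ltW|rewrite lerDl].
rewrite -ler_pdivlMr// => h; rewrite lerBlDr; have -> : 2 * l / c = 4 * l / c / 2 by field; rewrite gt_eqF.
lra.
Qed.

Lemma opdom_spectral_op e (a b : R) : opdom (spectral_op ip e a b) = setT.
Proof. by []. Qed.

(** Every unit vector is an eigenvector of a multiple of the identity, so the bound can be tested
    along [v t] itself; the waiting time in [eigencomponent_limsup] is uniform in the direction. *)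
Lemma scalar_velocity_bound e (r1 r2 : R) : 0 < r1 -> 0 < r2 ->
  velocity_bound ip (spectral_op ip e (r1 * r2) (r1 * r2)) (r1 + r2) (2 / r2).
Proof.
move=> r10 r20 f u v intf fy sol.
have [L L0 [fL _]] := ess_limsup_norm_eventually fy.
rewrite fL -EFinM; apply: limsup_norm_le => eps eps0.
have [T vT] := eigencomponent_limsup r10 r20 (opdom_spectral_op _ _ _) intf fL sol eps0.
exists T => t Tt; have [->|v0] := eqVneq (v t) 0.
  by rewrite normr0 addr_ge0 ?mulr_ge0 ?invr_ge0// ltW.
have nv : `|v t| != 0 by rewrite normr_eq0.
have := vT t Tt (`|v t|^-1 *: v t).
rewrite ipZr ip_norm expr2 mulKf//; apply; split=> [|x].
  by rewrite normrZ normrV ?unitfE// normr_id mulVf.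
by rewrite ip_spectral_op subrr !mul0r addr0.
Qed.

(** Adds the bounds for the component along [e] and for the orthogonal one. This crude sum serves to
    show that the optimal constant is finite. *)
Lemma spectral_velocity_bound e (r1 r2 q1 q2 : R) : `|e| = 1 ->
    0 < r1 -> 0 < r2 -> 0 < q1 -> 0 < q2 -> r1 + r2 = q1 + q2 ->
  velocity_bound ip (spectral_op ip e (r1 * r2) (q1 * q2)) (r1 + r2) (2 / r2 + 2 / q2).
Proof.
move=> e1 r10 r20 q10 q20 rq f u v intf fy sol.
have [L L0 [fL _]] := ess_limsup_norm_eventually fy.
rewrite fL -EFinM; apply: limsup_norm_le => eps eps0.
have eps2 : 0 < eps / 2 by rewrite divr_gt0.
have [T1 vT1] := eigencomponent_limsup r10 r20 (opdom_spectral_op _ _ _) intf fL sol eps2.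
rewrite rq in sol.
have [T2 vT2] := eigencomponent_limsup q10 q20 (opdom_spectral_op _ _ _) intf fL sol eps2.
exists (Num.max T1 T2) => t; rewrite ge_max => /andP[/vT1 {}vT1 /vT2 {}vT2].
pose p := v t - ip (v t) e *: e.
have pe : ip p e = 0 by rewrite ipBl ipZl ip_norm e1 expr1n mulr1 subrr.
have pL : `|p| <= 2 / r2 * L + eps / 2.
  have [->|p0] := eqVneq p 0.
    by rewrite normr0 addr_ge0 ?mulr_ge0 ?invr_ge0// ltW.
  have np : `|p| != 0 by rewrite normr_eq0.
  have vp : ip (v t) p = `|p| ^+ 2.
    by rewrite -ip_norm {2}/p ipBl ipZl (ipC ip e p) pe mulr0 subr0.
  have := vT1 (`|p|^-1 *: p); rewrite ipZr vp expr2 mulKf//; apply; split=> [|x].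
    by rewrite normrZ normrV ?unitfE// normr_id mulVf.
  by rewrite ip_spectral_op ipZl pe !mulr0 addr0.
have Ee : unit_eigenvector ip (spectral_op ip e (r1 * r2) (q1 * q2)) (q1 * q2) e.
  by split=> // x; rewrite ip_spectral_op ip_norm e1 expr1n; ring.
have qL : `|ip (v t) e| <= 2 / q2 * L + eps / 2.
  rewrite ler_norml lerNl; have vte := vT2 _ Ee.
  by have := vT2 _ (unit_eigenvectorN Ee); rewrite ipNr => ->.
have -> : v t = p + ip (v t) e *: e by rewrite subrK.
apply: le_trans (ler_normD _ _) _; rewrite normrZ e1 mulr1; lra.
Qed.

(** The infimum of the admissible constants is admissible, because for each fixed forcing the
    estimate passes to the limit. *)
Lemma optimal_velocity_bound_exists A (c K m : R) :
    velocity_bound ip A c K -> (forall K', velocity_bound ip A c K' -> m <= K') ->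
  exists2 K0, optimal_velocity_bound ip A c K0 & m <= K0 <= K.
Proof.
move=> vK mK; pose S := [set K' | velocity_bound ip A c K'].
have S0 : S !=set0 by exists K.
have lS : has_lbound S by exists m => K'; exact: mK.
have lowS K' : velocity_bound ip A c K' -> inf S <= K' by move=> vK'; exact: ge_inf.
exists (inf S); last by rewrite lowS// andbT; apply: lb_le_inf.
split=> // f u v intf fy sol.
have [L L0 [fL _]] := ess_limsup_norm_eventually fy.
rewrite fL; apply/lee_addgt0Pr => eps eps0.
(* With this slack on the constant, the error [eps L / (L + 1)] stays below [eps], also when
   [L = 0]. *)
have d0 : 0 < eps / (L + 1) by rewrite divr_gt0// ltr_wpDl.
have [K' vK' K'S] := inf_adherent d0 (conj S0 lS).
have := vK' f u v intf fy sol; rewrite fL; move/le_trans; apply.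
rewrite -!EFinM -EFinD lee_fin.
apply: (@le_trans _ _ ((inf S + eps / (L + 1)) * L)); first by rewrite ler_wpM2r// ltW.
rewrite mulrDl lerD2l mulrAC ler_pdivrMr ?ltr_wpDl//.
by rewrite ler_pM2l// lerDl.
Qed.

End velocity_bound_existence.

(** * Lower bounds from explicit solutions *)

Import HBSimple.

Section explicit_solutions.
Context (R : realType) (H : completeNormedModType R) (ip : {dot H for idfun}).
Hypothesis ip_norm : inner_product_of_norm ip.
Local Notation mu := (@lebesgue_measure R).
Variables (e1 e2 : H).
Hypotheses (e11 : `|e1| = 1) (e21 : `|e2| = 1) (e12 : ip e1 e2 = 0).

Definition plane_curve (y1 y2 : R -> R) (t : R) : H := y1 t *: e1 + y2 t *: e2.

Lemma cvg_plane_curve (F : set_system R) {FF : Filter F} (y1 y2 : R -> R) (a1 a2 : R) :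
    y1 t @[t --> F] --> a1 -> y2 t @[t --> F] --> a2 ->
  plane_curve y1 y2 t @[t --> F] --> a1 *: e1 + a2 *: e2.
Proof. by move=> y1a y2a; apply: cvgD; exact: cvgZr_tmp. Qed.

Lemma continuous_plane_curve (y1 y2 : R -> R) (D : set R) :
  continuous y1 -> continuous y2 -> {within D, continuous (plane_curve y1 y2)}.
Proof.
move=> cy1 cy2; apply: continuous_subspaceT => t.
by apply: cvg_plane_curve; [exact: cy1|exact: cy2].
Qed.

Lemma strongly_measurable_plane_curve (h1 h2 : R -> R) (D : set R) :
  continuous h1 -> continuous h2 -> strongly_measurable D (plane_curve h1 h2).
Proof.
move=> ch1 ch2.
have approx (h : R -> R) : continuous h -> exists s : nat -> R -> R,
    (forall n, finite_set (range (s n)) /\ forall x, measurable (s n @^-1` [set x])) /\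
    forall t, s n t @[n --> \oo] --> h t.
  move=> ch; have mh : measurable_fun setT (EFin \o h).
    by apply/measurable_EFinP; exact: continuous_measurable_fun.
  have [g gh] := approximation_sfun measurableT mh.
  exists (fun n t => g n t); split=> [n|t]; last exact/(fine_cvg (gh t I)).
  by split; [exact: fimfunP|move=> x; exact: measurable_funPTI].
have [s1 [ss1 s1h]] := approx _ ch1; have [s2 [ss2 s2h]] := approx _ ch2.
exists (fun n t => s1 n t *: e1 + s2 n t *: e2); split=> [n|t _]; last first.
  by apply: cvgD; exact: cvgZr_tmp.
have [fin1 m1] := ss1 n; have [fin2 m2] := ss2 n; split.
  apply: (@sub_finite_set _ _ ((fun p => p.1 *: e1 + p.2 *: e2) @` (range (s1 n) `*` range (s2 n)))).
    by move=> _ [t _ <-]; exists (s1 n t, s2 n t).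
  by apply: finite_image; exact: finite_setX.
(* The fibre over [x] is empty unless [x] lies in the plane of [e1] and [e2], where orthonormality
   makes it an intersection of two coordinate fibres. *)
move=> x; rewrite (_ : _ @^-1` _ =
    [set t | x = ip x e1 *: e1 + ip x e2 *: e2] `&`
    (s1 n @^-1` [set ip x e1] `&` s2 n @^-1` [set ip x e2])).
  apply: measurableI; last exact: measurableI.
  have [xE|xE] := pselect (x = ip x e1 *: e1 + ip x e2 *: e2).
    by rewrite [X in measurable X](_ : _ = setT)//; apply/seteqP; split.
  by rewrite [X in measurable X](_ : _ = set0)//; apply/seteqP; split.
apply/seteqP; split=> [t /= <-|t /= [xE [s1t s2t]]]; last by rewrite s1t s2t -xE.
rewrite !ipDl !ipZl !ip_norm e11 e21 (ipC ip e2 e1) e12 expr1n.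
by rewrite !mulr0 !mulr1 addr0 add0r.
Qed.

Lemma plane_curve_derivative (y1 y2 dy1 dy2 : R -> R) :
    (forall t : R, is_derive t 1 y1 (dy1 t)) -> (forall t : R, is_derive t 1 y2 (dy2 t)) ->
  derivative_on_nonneg (plane_curve y1 y2) (plane_curve dy1 dy2).
Proof.
move=> /[swap] d2 d1 t t0.
have quotE s : (s - t)^-1 *: (plane_curve y1 y2 s - plane_curve y1 y2 t) =
    ((s - t)^-1 * (y1 s - y1 t)) *: e1 + ((s - t)^-1 * (y2 s - y2 t)) *: e2.
  by rewrite /plane_curve opprD addrACA -!scalerBl scalerDr !scalerA.
under eq_fun do rewrite quotE.
have sub : within [set s | 0 <= s /\ s != t] (nbhs t) `=>` t^'.
  by apply: within_subset => s [].
apply: cvgD; apply: cvgZr_tmp; apply: cvg_trans (cvg_app _ sub) _.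
  by have /is_derive1_quotientP := d1 t.
by have /is_derive1_quotientP := d2 t.
Qed.

(** Any such plane curve is a solution once the forcing is defined as the residual of the equation.
    A curve whose forcing stays below [M] while its speed keeps returning to [m] therefore limits
    [K] from below. *)
Lemma velocity_bound_lower (l1 l2 c M m K : R) (y1 y2 dy1 dy2 ddy1 ddy2 : R -> R) :
    0 <= l1 -> 0 <= l2 -> 0 < m ->
    (forall t : R, is_derive t 1 y1 (dy1 t)) -> (forall t : R, is_derive t 1 y2 (dy2 t)) ->
    (forall t : R, is_derive t 1 dy1 (ddy1 t)) -> (forall t : R, is_derive t 1 dy2 (ddy2 t)) ->
    continuous ddy1 -> continuous ddy2 ->
    (forall t, (ddy1 t + c * dy1 t + l1 ^+ 2 * y1 t) ^+ 2 +
               (ddy2 t + c * dy2 t + l2 ^+ 2 * y2 t) ^+ 2 <= M ^+ 2) ->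
    0 <= M ->
    (forall T, exists2 t, T < t & m ^+ 2 <= dy1 t ^+ 2 + dy2 t ^+ 2) ->
    velocity_bound ip (spectral_op ip e2 (l1 ^+ 2) (l2 ^+ 2)) c K ->
  m <= K * M.
Proof.
move=> l10 l20 m0 dy1P dy2P ddy1P ddy2P cdd1 cdd2 fM M0 vm vK.
have cy1 := is_derive_continuous dy1P; have cy2 := is_derive_continuous dy2P.
have cdy1 := is_derive_continuous ddy1P; have cdy2 := is_derive_continuous ddy2P.
pose h1 t := ddy1 t + c * dy1 t + l1 ^+ 2 * y1 t.
pose h2 t := ddy2 t + c * dy2 t + l2 ^+ 2 * y2 t.
have ch1 : continuous h1.
  by move=> t; apply: cvgD; [apply: cvgD; [exact: cdd1|]|]; apply: cvgMr; [exact: cdy1|exact: cy1].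
have ch2 : continuous h2.
  by move=> t; apply: cvgD; [apply: cvgD; [exact: cdd2|]|]; apply: cvgMr; [exact: cdy2|exact: cy2].
pose f := plane_curve h1 h2; pose u := plane_curve y1 y2; pose v := plane_curve dy1 dy2.
have fle t : `|f t| <= M.
  by rewrite -(@ler_pXn2r _ 2) ?nnegrE// (norm_comb2 ip_norm)//; exact: fM.
have smf D : strongly_measurable D f by exact: strongly_measurable_plane_curve.
have intf (T : R) : 0 < T -> bochner_integrable `]0, T[ f.
  move=> T0; split=> //.
  have mf := strongly_measurable_comp (phi := fun x => `|x|) (@norm_continuous _ _) (smf `]0, T[%classic).
  have := @ge0_le_integral _ _ _ mu _ (measurable_itv `]0, T[)
    (fun t => `|f t|%:E) (cst M%:E).
  rewrite integral_cst//= lebesgue_measure_itv/= lte_fin T0 => le.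
  apply: (@le_lt_trans _ _ (M%:E * (T%:E + (- 0)%:E))%E); last by rewrite -EFinD -EFinM ltry.
  by apply: le => // [|x _]; [exact/measurable_EFinP|rewrite lee_fin].
have fL : (ess_limsup_norm f <= M%:E)%E by apply: ess_limsup_norm_le => t _.
have sol : weak_solution ip (spectral_op ip e2 (l1 ^+ 2) (l2 ^+ 2)) c f u v.
  exists (spectral_op ip e2 l1 l2); first exact: spectral_op_sqrt.
  have BuE : spectral_op ip e2 l1 l2 \o u =
      plane_curve (fun t => l1 * y1 t) (fun t => l2 * y2 t).
    apply/funext => t; rewrite /= /u/plane_curve ipDl !ipZl e12 ip_norm e21 expr1n.
    rewrite mulr0 add0r mulr1 scalerDr !scalerA -addrA -scalerDl.
    by congr (_ + _ *: _); ring.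
  split=> //.
  - exact: continuous_plane_curve.
  - rewrite BuE; apply: continuous_plane_curve => t; apply: cvgMr; [exact: cy1|exact: cy2].
  - split; [exact: plane_curve_derivative|exact: continuous_plane_curve].
  move=> w t _; rewrite le_eqVlt => /predU1P[<-|t0].
    by rewrite set_itvoo0 Rintegral_set0 addr0.
  pose g x := ddy1 x * ip e1 w + ddy2 x * ip e2 w.
  have cg (x : R) : {for x, continuous g}.
    by apply: cvgD; apply: cvgMl; [exact: cdd1|exact: cdd2].
  have dv (x : R) : is_derive x 1 (fun s => ip (v s) w) (g x).
    have -> : (fun s => ip (v s) w) = (fun s => ip e1 w *: dy1 s + ip e2 w *: dy2 s).
      by apply/funext => s; rewrite /v/plane_curve ipDl !ipZl mulrC; congr (_ + _); exact: mulrC.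
    have -> : g x = ip e1 w *: ddy1 x + ip e2 w *: ddy2 x by rewrite /g mulrC; congr (_ + _); exact: mulrC.
    by apply: is_deriveD; apply: is_deriveZ.
  have := @Rintegral_FTC2 _ g (fun s => ip (v s) w) 0 t t0 (fun x _ _ => dv x) (fun x _ _ => cg x).
  rewrite -Rintegral_itv_bndo_bndc; last first.
    apply: (@integrableS _ _ _ mu `]0, t]) => //; last exact: continuous_integrable.
    by apply: subset_itvl; rewrite bnd_simp.
  move=> vg; rewrite -[LHS](subrK (ip (v 0) w)) -vg addrC; congr (_ + _).
  apply: eq_Rintegral => x _; rewrite -spectral_op_sym// spectral_op_comp//.
  rewrite ip_spectral_op /f/v/u/plane_curve !ipDl !ipZl e12 ip_norm e21 expr1n /g/h1/h2.
  by rewrite (ipC ip w e2); ring.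
have := vK f u v intf (le_lt_trans fL (ltry _)) sol.
have vlow : (m%:E <= limsup_norm v)%E.
  apply: limsup_norm_ge => T; have [t Tt mt] := vm T; exists t => //.
  by rewrite -(@ler_pXn2r _ 2) ?nnegrE ?(ltW m0)// (norm_comb2 ip_norm).
move=> /(le_trans vlow).
have [L L0 [LE _]] := ess_limsup_norm_eventually (le_lt_trans fL (ltry _)).
rewrite LE -EFinM lee_fin => mKL; rewrite LE lee_fin in fL.
have K0 : 0 <= K.
  rewrite leNgt; apply/negP => K0; have := lt_le_trans m0 mKL.
  by rewrite ltNge mulr_le0_ge0// ltW.
by apply: (le_trans mKL); rewrite ler_wpM2l.
Qed.

End explicit_solutions.

(** * The periodic profile *)

Section slow_profile.
Context (R : realType).
Implicit Types (f g : R -> R) (t k : R).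

Lemma is_derive_mul f g t (df dg : R) : is_derive t 1 f df -> is_derive t 1 g dg ->
  is_derive t 1 (fun x => f x * g x) (df * g t + f t * dg).
Proof.
move=> fP gP; have := is_deriveM fP gP => h.
by apply: is_derive_eq h _; rewrite addrC; congr (_ + _); exact: mulrC.
Qed.

Lemma is_derive_add f g t (df dg : R) : is_derive t 1 f df -> is_derive t 1 g dg ->
  is_derive t 1 (fun x => f x + g x) (df + dg).
Proof. by move=> fP gP; exact: is_deriveD. Qed.

Lemma is_derive_const k t : is_derive t 1 (fun _ : R => k) 0.
Proof. exact: is_derive_cst. Qed.

Lemma is_derive_scale k f t (df : R) : is_derive t 1 f df ->
  is_derive t 1 (fun x => k * f x) (k * df).
Proof. by move=> fP; exact: is_deriveZ. Qed.

Lemma is_derive_chain f g t (df dg : R) : is_derive (g t) 1 f df -> is_derive t 1 g dg ->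
  is_derive t 1 (fun x => f (g x)) (dg * df).
Proof. by move=> fP gP; rewrite mulrC; exact: is_derive1_comp. Qed.

Variables (N b mu : R).
Hypotheses (N0 : 0 < N) (b0 : 0 < b) (mu0 : 0 < mu).

(* Writing [softplus y = ln (1 + mu e^(N y)) / N], one has
   [profile_g t = exp (- softplus (b sin t))] and [profile_p] is the derivative
   of [softplus] at [b sin t]. As [0 <= softplus' <= 1], the function
   [w = 2 exp (- softplus) - 1] satisfies [-1 <= w + w' <= 1] although [w'] gets
   close to [-2]: it is a smooth version of the relaxation following a jump of
   the forcing from [1] to [-1]. The envelope [(1 + cos t) / 2] damps this
   component where [sin] decreases, leaving room there for the forcing
   [(1 - cos t) / 2] of the other component. *)
Definition profile_exp t := mu * expR (N * b * sin t).
Definition profile_p t := 1 - (1 + profile_exp t)^-1.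
Definition profile_g t := expR (- N^-1 * ln (1 + profile_exp t)).

Lemma profile_exp_gt0 t : 0 < profile_exp t.
Proof. by rewrite mulr_gt0// expR_gt0. Qed.

Lemma is_derive_profile_exp t :
  is_derive t 1 profile_exp (N * b * cos t * profile_exp t).
Proof.
have := is_derive_scale mu (is_derive_chain (is_derive_expR _)
  (is_derive_scale (N * b) (is_derive_sin t))).
by move=> h; apply: is_derive_eq h _; rewrite /profile_exp; ring.
Qed.

Let X1 t : 0 < 1 + profile_exp t.
Proof. by rewrite addr_gt0// profile_exp_gt0. Qed.

Lemma is_derive_profile_p t :
  is_derive t 1 profile_p (N * b * cos t * profile_p t * (1 - profile_p t)).
Proof.
have dX := is_derive_add (is_derive_const 1 t) (is_derive_profile_exp t).
have dV := @is_deriveV _ (fun x => 1 + profile_exp x) t _ 1 (lt0r_neq0 (X1 t)) dX.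
have h := is_derive_add (is_derive_const 1 t) (is_derive_scale (-1) dV).
rewrite (_ : profile_p = fun x => 1 + -1 * (1 + profile_exp x)^-1); last first.
  by apply/funext => x; rewrite mulN1r.
apply: is_derive_eq h _; rewrite /profile_p /GRing.scale/=; field.
by rewrite gt_eqF.
Qed.

Lemma is_derive_profile_g t :
  is_derive t 1 profile_g (- (b * cos t * profile_g t * profile_p t)).
Proof.
have dX := is_derive_add (is_derive_const 1 t) (is_derive_profile_exp t).
have dL := is_derive_chain (g := fun x => 1 + profile_exp x) (is_derive1_ln (X1 t)) dX.
have h := is_derive_chain (is_derive_expR _) (is_derive_scale (- N^-1) dL).
apply: is_derive_eq h _; rewrite -/(profile_g t) /profile_p; field.
by rewrite !gt_eqF.
Qed.

Lemma profile_p_itv t : 0 <= profile_p t <= 1.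
Proof.
rewrite subr_ge0 gerBl invr_ge0 (ltW (X1 t)) andbT.
by rewrite invf_le1// lerDl ltW// profile_exp_gt0.
Qed.

Lemma profile_g_itv t : 0 <= profile_g t <= 1.
Proof.
rewrite expR_ge0/= -expR0 ler_expR mulNr oppr_le0; apply: mulr_ge0.
  by rewrite invr_ge0 ltW.
by rewrite ln_ge0// lerDl ltW// profile_exp_gt0.
Qed.

(** Envelope times [w], divided by [b] so that [b U2 + U2'] is the second force in
    [profile_force_le1] up to a term of order [1 / b]. *)
Definition profile_U2 t := (1 + cos t) / 2 * (2 * profile_g t - 1) / b.
Definition profile_dU2 t :=
  - (sin t * (2 * profile_g t - 1)) / (2 * b) -
  (1 + cos t) * cos t * profile_g t * profile_p t.
Definition profile_ddU2 t :=
  - (cos t * (2 * profile_g t - 1)) / (2 * b) +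
  sin t * cos t * profile_g t * profile_p t +
  (sin t * (1 + 2 * cos t)) * profile_g t * profile_p t +
  (1 + cos t) * b * cos t ^+ 2 * profile_g t * profile_p t ^+ 2 -
  (1 + cos t) * N * b * cos t ^+ 2 * profile_g t * profile_p t * (1 - profile_p t).

Lemma is_derive_profile_U2 t : is_derive t 1 profile_U2 (profile_dU2 t).
Proof.
have dC := is_derive_add (is_derive_const 1 t) (is_derive_cos t).
have dG := is_derive_add (is_derive_scale 2 (is_derive_profile_g t)) (is_derive_const (-1) t).
have h := is_derive_scale (2 * b)^-1 (is_derive_mul dC dG).
rewrite (_ : profile_U2 = fun x => (2 * b)^-1 * ((1 + cos x) * (2 * profile_g x + -1))).
  apply: is_derive_eq h _; rewrite /profile_dU2; field.
  by rewrite gt_eqF.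
by apply/funext => x; rewrite /profile_U2; field; rewrite gt_eqF.
Qed.

Lemma is_derive_profile_dU2 t : is_derive t 1 profile_dU2 (profile_ddU2 t).
Proof.
have dC := is_derive_add (is_derive_const 1 t) (is_derive_cos t).
have dG := is_derive_add (is_derive_scale 2 (is_derive_profile_g t)) (is_derive_const (-1) t).
have h1 := is_derive_scale (- (2 * b)^-1) (is_derive_mul (is_derive_sin t) dG).
have h2 := is_derive_scale (-1) (is_derive_mul (is_derive_mul (is_derive_mul dC (is_derive_cos t))
  (is_derive_profile_g t)) (is_derive_profile_p t)).
have h := is_derive_add h1 h2.
rewrite (_ : profile_dU2 = fun x => - (2 * b)^-1 * (sin x * (2 * profile_g x + -1)) +
   -1 * ((1 + cos x) * cos x * profile_g x * profile_p x)).
  apply: is_derive_eq h _; rewrite /profile_ddU2; field.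
  by rewrite gt_eqF.
by apply/funext => x; rewrite /profile_dU2; field; rewrite gt_eqF.
Qed.


Lemma continuous_profile_ddU2 : continuous profile_ddU2.
Proof.
have cg := is_derive_continuous is_derive_profile_g.
have cp := is_derive_continuous is_derive_profile_p.
have -> : profile_ddU2 = fun t =>
    - (2 * b)^-1 * (cos t * (2 * profile_g t + -1)) +
    sin t * cos t * profile_g t * profile_p t +
    sin t * (1 + 2 * cos t) * profile_g t * profile_p t +
    b * ((1 + cos t) * (cos t * cos t) * profile_g t * (profile_p t * profile_p t)) +
    - (N * b) * ((1 + cos t) * (cos t * cos t) * profile_g t * profile_p t * (1 + -1 * profile_p t)).
  by apply/funext => t; rewrite /profile_ddU2; field; rewrite gt_eqF.
have cs := @continuous_sin R; have cc := @continuous_cos R.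
move: (profile_g) (profile_p) (@sin R) (@cos R) cg cp cs cc => g p s c cg cp cs cc.
have cM (h1 h2 : R -> R) : continuous h1 -> continuous h2 -> continuous (fun t => h1 t * h2 t).
  by move=> c1 c2 t; apply: cvgM; [exact: c1|exact: c2].
have cD (h1 h2 : R -> R) : continuous h1 -> continuous h2 -> continuous (fun t => h1 t + h2 t).
  by move=> c1 c2 t; apply: cvgD; [exact: c1|exact: c2].
have cK (k : R) : continuous (fun _ : R => k) by move=> t; exact: cvg_cst.
have c1 := cD _ _ (cK 1) cc; have c2 := cM _ _ cc cc; have c1p := cD _ _ (cK 1) (cM _ _ (cK (-1)) cp).
have cg2 := cD _ _ (cM _ _ (cK 2) cg) (cK (-1)).
have T1 := cM _ _ (cK (- (2 * b)^-1)) (cM _ _ cc cg2).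
have T2 := cM _ _ (cM _ _ (cM _ _ cs cc) cg) cp.
have T3 := cM _ _ (cM _ _ (cM _ _ cs (cD _ _ (cK 1) (cM _ _ (cK 2) cc))) cg) cp.
have T4 := cM _ _ (cK b) (cM _ _ (cM _ _ (cM _ _ c1 c2) cg) (cM _ _ cp cp)).
have T5 := cM _ _ (cK (- (N * b))) (cM _ _ (cM _ _ (cM _ _ (cM _ _ c1 c2) cg) cp) c1p).
exact (cD _ _ (cD _ _ (cD _ _ (cD _ _ T1 T2) T3) T4) T5).
Qed.

Lemma le_norm_mul (x y u v : R) : `|x| <= u -> `|y| <= v -> `|x * y| <= u * v.
Proof. by move=> xu yv; rewrite normrM ler_pM. Qed.

Let normC t : `|cos t| <= 1. Proof. by rewrite ler_norml cos_geN1 cos_le1. Qed.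
Let normS t : `|sin t| <= 1. Proof. by rewrite ler_norml sin_geN1 sin_le1. Qed.
Let normp t : `|profile_p t| <= 1.
Proof. by have /andP[p0 p1] := profile_p_itv t; rewrite ger0_norm. Qed.
Let normg t : `|profile_g t| <= 1.
Proof. by have /andP[g0 g1] := profile_g_itv t; rewrite ger0_norm. Qed.

Let normg2 t : `|2 * profile_g t - 1| <= 1.
Proof. have /andP[g0 g1] := profile_g_itv t; rewrite ler_norml; lra. Qed.

(** What matters is uniformity in [t]: the dilated equation multiplies this term by [1 / c^2]. *)
Lemma profile_ddU2_bound t :
  `|profile_ddU2 t| <= (2 * b)^-1 + 4 + 2 * b + 2 * N * b.
Proof.
have b20 : 0 < 2 * b by rewrite mulr_gt0.
have T1 : `|- (cos t * (2 * profile_g t - 1)) / (2 * b)| <= 1 * 1 * (2 * b)^-1.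
  by apply: le_norm_mul; [rewrite normrN; exact: le_norm_mul|rewrite ger0_norm// invr_ge0 ltW].
have T2 : `|sin t * cos t * profile_g t * profile_p t| <= 1 * 1 * 1 * 1.
  by do 3!apply: le_norm_mul => //.
have T3 : `|(sin t * (1 + 2 * cos t)) * profile_g t * profile_p t| <= 1 * 3 * 1 * 1.
  do 3!apply: le_norm_mul => //; have := normC t; rewrite !ler_norml => /andP[]; lra.
have T4 : `|(1 + cos t) * b * cos t ^+ 2 * profile_g t * profile_p t ^+ 2| <=
    2 * b * (1 * 1) * 1 * (1 * 1).
  apply: le_norm_mul; last exact: le_norm_mul.
  apply: le_norm_mul => //; apply: le_norm_mul; last exact: le_norm_mul.
  apply: le_norm_mul; last by rewrite gtr0_norm.
  by have := normC t; rewrite !ler_norml => /andP[]; lra.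
have T5 : `|(1 + cos t) * N * b * cos t ^+ 2 * profile_g t * profile_p t * (1 - profile_p t)| <=
    2 * N * b * (1 * 1) * 1 * 1 * 1.
  apply: le_norm_mul; last first.
    by have /andP[p0 p1] := profile_p_itv t; rewrite ler_norml; lra.
  do 2!apply: le_norm_mul => //; apply: le_norm_mul; last exact: le_norm_mul.
  apply: le_norm_mul; last by rewrite gtr0_norm.
  apply: le_norm_mul; last by rewrite gtr0_norm.
  by have := normC t; rewrite !ler_norml => /andP[]; lra.
have sum5 (x1 x2 x3 x4 x5 k1 k2 k3 k4 k5 : R) : `|x1| <= k1 -> `|x2| <= k2 ->
    `|x3| <= k3 -> `|x4| <= k4 -> `|x5| <= k5 ->
    `|x1 + x2 + x3 + x4 - x5| <= k1 + k2 + k3 + k4 + k5.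
  rewrite !ler_norml => /andP[? ?] /andP[? ?] /andP[? ?] /andP[? ?] /andP[? ?].
  by apply/andP; split; lra.
by apply: le_trans (sum5 _ _ _ _ _ _ _ _ _ _ T1 T2 T3 T4 T5) _; lra.
Qed.

(** Leading part of the rescaled forcing. Where [cos t >= 0] the relaxation gives [|q| <= 1], and
    the squared envelopes sum to at most [1]; where [cos t < 0] the factor [q] may exceed [1], but
    the envelope [(1 + cos t) / 2] compensates. *)
Lemma profile_force_le1 t :
  ((1 - cos t) / 2) ^+ 2 +
  ((1 + cos t) / 2 * (2 * profile_g t - 1 - 2 * profile_g t * profile_p t * cos t)) ^+ 2 <= 1.
Proof.
have /andP[g0 g1] := profile_g_itv t; have /andP[p0 p1] := profile_p_itv t.
have := normC t; rewrite ler_norml => /andP[C1 C2].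
move: (profile_g t) (profile_p t) (cos t) g0 g1 p0 p1 C1 C2 => g p C g0 g1 p0 p1 C1 C2.
set q := 2 * g - 1 - _.
have gp0 : 0 <= g * p by exact: mulr_ge0.
have gp1 : g * p <= g by rewrite ler_piMr.
have E0 : 0 <= (1 + C) / 2 by lra.
have bound k : `|q| <= k -> ((1 + C) / 2 * q) ^+ 2 <= ((1 + C) / 2 * k) ^+ 2.
  move=> qk; have Eqk : `|(1 + C) / 2 * q| <= (1 + C) / 2 * k.
    by rewrite normrM ger0_norm// ler_wpM2l.
  by rewrite -[leLHS]real_normK ?num_real// !expr2 ler_pM.
have [C0|C0] := leP 0 C.
  have : `|q| <= 1.
    rewrite ler_norml /q; have h1 : 0 <= g * p * C by exact: mulr_ge0.
    have h2 : g * p * C <= g * p by rewrite ler_piMr.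
    by apply/andP; split; lra.
  by move=> /bound; nra.
have : `|q| <= 1 - 2 * C.
  rewrite ler_norml /q; have h1 : 0 <= g * p * (- C) by rewrite mulr_ge0// oppr_ge0 ltW.
  have h2 : g * p * (- C) <= 1 * (- C) by rewrite ler_wpM2r ?oppr_ge0 ?(ltW C0)//; lra.
  by apply/andP; split; lra.
move=> /bound h; apply: (le_trans (lerD (lexx _) h)).
(* Here [r] lies in [[0, 1]], so [r^3 <= r^2] bounds the polynomial factor below by
   [4 - 10 r + 8 r^2], whose discriminant is negative. *)
pose r := 1 + C; have -> : C = r - 1 by rewrite /r; ring.
have r0 : 0 <= r by rewrite /r; lra.
have r1 : r <= 1 by rewrite /r; lra.
have -> : ((1 - (r - 1)) / 2) ^+ 2 + ((1 + (r - 1)) / 2 * (1 - 2 * (r - 1))) ^+ 2 =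
  1 - r * (4 - 10 * r + 12 * r ^+ 2 - 4 * r ^+ 3) / 4 by field.
rewrite gerBl divr_ge0// mulr_ge0//.
have r3 : r ^+ 3 <= r ^+ 2 by rewrite exprSr ler_piMr ?exprn_ge0.
have : 0 <= (4 * r - 5) ^+ 2 by exact: sqr_ge0.
nra.
Qed.

(** The times at which the speed is evaluated: there [U2' = - 2 g p], close to [-2] when [mu] is
    large and [mu / N] small. The bound on [g] combines [exp x >= 1 + x] with [ln (1 + x) <= x]. *)
Lemma profile_at_2pi (n : nat) (t := n%:R * (2 * pi)) :
  [/\ 1 - mu / N <= profile_g t, profile_p t = mu / (1 + mu), sin t = 0 & cos t = 1].
Proof.
have tE : t = 0 + (pi *+ 2) *+ n by rewrite /t add0r mulr_natl; congr (_ *+ _); rewrite mulr_natl.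
have s0 : sin t = 0 by rewrite tE periodicn ?sin0//; exact: sinD2pi.
have c1 : cos t = 1 by rewrite tE periodicn ?cos0//; exact: cosD2pi.
have XE : profile_exp t = mu by rewrite /profile_exp s0 mulr0 expR0 mulr1.
split=> //; last by rewrite /profile_p XE; field; rewrite gt_eqF// addr_gt0.
rewrite /profile_g XE; apply: le_trans (expR_ge1Dx _); rewrite mulNr lerD2l lerN2 mulrC.
by rewrite ler_wpM2r ?invr_ge0 ?(ltW N0)// le_ln1Dx// (lt_trans _ mu0).
Qed.

End slow_profile.

(** * Lower bound for the anisotropic operator *)

Section counterexample.
Context (R : realType) (H : completeNormedModType R) (ip : {dot H for idfun}).
Hypothesis ip_norm : inner_product_of_norm ip.
Variables (e1 e2 : H).
Hypotheses (e11 : `|e1| = 1) (e21 : `|e2| = 1) (e12 : ip e1 e2 = 0).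

Lemma unbounded_multiples (c T : R) : 0 < c ->
  exists n : nat, T < c * (n%:R * (2 * pi)).
Proof.
move=> c0; have k0 : 0 < c * (2 * pi) by rewrite !mulr_gt0// pi_gt0.
exists (Num.bound `|T / (c * (2 * pi))|).
rewrite mulrCA -ltr_pdivrMr//; apply: le_lt_trans (ler_norm _) _.
exact: archi_boundP.
Qed.

(** The oscillation [sin t] along [e1] has a velocity that keeps returning to [1]. Positivity gives
    the lower bound that the infimum of the admissible constants needs. *)
Lemma velocity_bound_gt0 (l1 l2 c K : R) : 0 <= l1 -> 0 <= l2 -> 0 < c ->
  velocity_bound ip (spectral_op ip e2 (l1 ^+ 2) (l2 ^+ 2)) c K -> 0 < K.
Proof.
move=> l10 l20 c0 vK.
have M0 : 0 < 1 + c + l1 ^+ 2 by rewrite ltr_wpDr ?exprn_ge0// addr_gt0.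
suff : 1 <= K * (1 + c + l1 ^+ 2) by move=> /(lt_le_trans ltr01); rewrite pmulr_lgt0.
apply: (@velocity_bound_lower _ _ _ ip_norm _ _ e11 e21 e12 l1 l2 c _ _ _
  sin (cst 0) cos (cst 0) (fun t => - sin t) (cst 0)) => //.
- by move=> t; apply: continuousN; exact: continuous_sin.
- by move=> t; exact: cvg_cst.
- move=> t; rewrite /= !mulr0 !addr0 [X in _ + X]expr0n addr0.
  have S1 : `|sin t| <= 1 by rewrite ler_norml sin_geN1 sin_le1.
  have C1 : `|cos t| <= 1 by rewrite ler_norml cos_geN1 cos_le1.
  have F1 : `|- sin t + c * cos t + l1 ^+ 2 * sin t| <= 1 + c + l1 ^+ 2.
    apply: le_trans (ler_normD _ _) _; apply: lerD.
      apply: le_trans (ler_normD _ _) _; rewrite normrN normrM (ger0_norm (ltW c0)).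
      by apply: lerD => //; rewrite ler_piMr// ltW.
    by rewrite normrM ger0_norm ?exprn_ge0// ler_piMr// exprn_ge0.
  by rewrite -[leLHS]real_normK ?num_real// !expr2 ler_pM.
- exact: ltW.
- move=> T; have [n nT] := unbounded_multiples T ltr01.
  exists (1 * (n%:R * (2 * pi))) => //.
  (* Arbitrary profile parameters: the value of [cos] is what is extracted. *)
  have [_ _ _ c1] := @profile_at_2pi R 1 1 1 ltr01 ltr01 n.
  by rewrite mul1r c1 expr1n expr0n addr0.
Qed.

Lemma is_derive_dilate (k t : R) (g : R -> R) (dg : R) :
  is_derive (k * t) 1 g dg -> is_derive t 1 (fun s => g (k * s)) (k * dg).
Proof.
move=> gP; have h := is_derive_chain gP (is_derive_scale k (is_derive_id t 1)).
by apply: is_derive_eq h _; rewrite mulr1.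
Qed.

(** The perturbation has norm at most [sqrt 2 d <= 2 d]; in expanded form,
    [1 + 4 d + 2 d^2 <= (1 + 2 d)^2]. *)
Lemma sum_sqr_perturb (x y dx dy d : R) : x ^+ 2 + y ^+ 2 <= 1 ->
  `|dx| <= d -> `|dy| <= d -> (x + dx) ^+ 2 + (y + dy) ^+ 2 <= (1 + 2 * d) ^+ 2.
Proof.
move=> xy dxd dyd; have d0 : 0 <= d by exact: le_trans dxd.
have small (z w : R) : z ^+ 2 <= 1 -> `|w| <= d -> z * w <= d /\ w ^+ 2 <= d ^+ 2.
  move=> z1 wd; have zn : `|z| <= 1.
    by rewrite -(@ler_pXn2r _ 2) ?nnegrE// real_normK ?num_real// expr1n.
  split; first by rewrite (le_trans (ler_norm _))// normrM -[d]mul1r ler_pM.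
  by rewrite -real_normK ?num_real// !expr2 ler_pM.
have x1 : x ^+ 2 <= 1 by apply: le_trans xy; rewrite lerDl sqr_ge0.
have y1 : y ^+ 2 <= 1 by apply: le_trans xy; rewrite lerDr sqr_ge0.
have [? ?] := small x dx x1 dxd; have [? ?] := small y dy y1 dyd.
by rewrite !sqrrD; nra.
Qed.

(** [1 / 4] and [4 (g p)^2] are the squared speeds of the two components at multiples of [2 pi], so
    the plane speed exceeds [2] there by a definite margin. *)
Lemma velocity_numerics (g p : R) : 1 - 1 / 500 <= g -> 1 - 1 / 500 <= p ->
  (41 / 20) ^+ 2 <= 1 / 4 + 4 * (g * p) ^+ 2.
Proof.
move=> gl pl; have gp : 249 / 250 <= g * p.
  by apply: (@le_trans _ _ ((1 - 1 / 500) * (1 - 1 / 500))); [lra|apply: ler_pM; lra].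
have : (249 / 250) ^+ 2 <= (g * p) ^+ 2 by rewrite !expr2; apply: ler_pM; lra.
lra.
Qed.

(** The curve is the dilation by [c] of the slow component [1 / (2 a) - sin / 2] and the fast
    component [U2], so its velocity is [U' / c]. In each coordinate [51 / (100 * 100)] bounds the
    distance of the forcing from its leading part. *)
Lemma anisotropic_lower_bound (l1 l2 N mu c K : R) (D := (2 * l2 ^+ 2)^-1 + 4 + 2 * l2 ^+ 2 + 2 * N * l2 ^+ 2) :
    0 < l1 -> l1 ^+ 2 <= 1 / 100 -> 0 < l2 -> 100 <= l2 ^+ 2 ->
    0 < N -> 0 < mu -> mu / N <= 1 / 500 -> 1 - 1 / 500 <= mu / (1 + mu) ->
    100 * 100 * (D + 1) <= c ->
    velocity_bound ip (spectral_op ip e2 (l1 ^+ 2) (l2 ^+ 2)) c K ->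
  41 / 20 / c <= K * (1 + 2 * (51 / (100 * 100))).
Proof.
move=> l10 l1a l20 l2b N0 mu0 muN muP cD vK.
set a := l1 ^+ 2 in l1a *; set b := l2 ^+ 2 in l2b D cD *.
have a0 : 0 < a by rewrite exprn_gt0.
have b0 : 0 < b by rewrite exprn_gt0.
have b2 : (2 * b)^-1 <= 1 / 200.
  by rewrite div1r lef_pV2 ?posrE; lra.
have b2' : 0 < (2 * b)^-1 by rewrite invr_gt0 mulr_gt0.
have Nb0 : 0 < N * b by rewrite mulr_gt0.
have D0 : 0 < D by rewrite /D -[2 * N * b]mulrA; lra.
pose U2 := profile_U2 N b mu; pose dU2 := profile_dU2 N b mu.
pose ddU2 := profile_ddU2 N b mu.
have c1 : 1 <= c by lra.
have c0 : 0 < c by lra.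
pose k := c^-1.
have k0 : 0 < k by rewrite invr_gt0.
have kc : k * c = 1 by rewrite mulVf ?gt_eqF.
have k2 : k ^+ 2 * (D + 1) <= 1 / (100 * 100).
  have kD : k * (100 * 100 * (D + 1)) <= 1.
    by have := ler_wpM2l (ltW k0) cD; rewrite kc.
  have k1 : k <= 1 by rewrite invf_le1.
  have : k * (k * (100 * 100 * (D + 1))) <= 1 * 1.
    by rewrite ler_pM ?(ltW k0)// mulr_ge0 ?(ltW k0)//; lra.
  by rewrite expr2; lra.
have k2D : 0 <= k ^+ 2 * D by rewrite mulr_ge0 ?exprn_ge0 ?ltW.
have k20 : 0 <= k ^+ 2 by rewrite exprn_ge0 ?ltW.
rewrite mulrDr mulr1 in k2.
(* The constant is in equilibrium with the mean forcing [1 / 2]; the oscillation adds [- cos / 2],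
   so the leading forcing is [(1 - cos) / 2]. *)
pose y1 t := (2 * a)^-1 - 1 / 2 * sin (k * t).
pose dy1 t := - (k / 2) * cos (k * t).
pose ddy1 t := k ^+ 2 / 2 * sin (k * t).
pose y2 t := U2 (k * t).
pose dy2 t := k * dU2 (k * t).
pose ddy2 t := k * (k * ddU2 (k * t)).
apply: (@velocity_bound_lower _ _ _ ip_norm _ _ e11 e21 e12 l1 l2 c _ _ _
  y1 y2 dy1 dy2 ddy1 ddy2 _ _ _ _ _ _ _ _ _ _ _ _ vK).
- exact: ltW.
- exact: ltW.
- by rewrite divr_gt0// divr_gt0.
- move=> t; have h := is_derive_add (is_derive_const (2 * a)^-1 t)
    (is_derive_scale (- (1 / 2)) (is_derive_dilate (is_derive_sin (k * t)))).
  rewrite (_ : y1 = fun s => (2 * a)^-1 + - (1 / 2) * sin (k * s)); last first.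
    by apply/funext => s; rewrite /y1 mulNr.
  by apply: is_derive_eq h _; rewrite /dy1; ring.
- by move=> t; apply: is_derive_dilate; exact: (is_derive_profile_U2 N0 b0 mu0).
- move=> t; have h := is_derive_scale (- (k / 2)) (is_derive_dilate (is_derive_cos (k * t))).
  by apply: is_derive_eq h _; rewrite /ddy1; ring.
- move=> t; apply: is_derive_scale; apply: is_derive_dilate.
  exact: (is_derive_profile_dU2 N0 b0 mu0).
- by move=> t; apply: cvgMr; apply: continuous_comp; [apply: cvgMr; exact: cvg_id|exact: continuous_sin].
- move=> t; do 2!apply: cvgMr; apply: continuous_comp; first by apply: cvgMr; exact: cvg_id.
  exact: continuous_profile_ddU2.
- move=> t; set s := k * t.
  have S1 : `|sin s| <= 1 by rewrite ler_norml sin_geN1 sin_le1.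
  have /andP[g0 g1] := profile_g_itv b N0 mu0 s.
  have ddb : `|ddU2 s| <= D := profile_ddU2_bound N0 b0 mu0 s.
  have force := profile_force_le1 b N0 mu0 s.
  have -> : ddy1 t + c * dy1 t + a * y1 t = (1 - cos s) / 2 + (k ^+ 2 / 2 - a / 2) * sin s.
    rewrite /ddy1 /dy1 /y1 -/s mulNr mulrN mulrA [c * _]mulrA [c * k]mulrC kc.
    by field; rewrite gt_eqF.
  have -> : ddy2 t + c * dy2 t + b * y2 t =
      (1 + cos s) / 2 * (2 * profile_g N b mu s - 1 -
        2 * profile_g N b mu s * profile_p N b mu s * cos s) +
      (k ^+ 2 * ddU2 s - (2 * b)^-1 * (sin s * (2 * profile_g N b mu s - 1))).
    rewrite /ddy2 /dy2 /y2 -/s [c * _]mulrA [c * k]mulrC kc /dU2 /U2 /profile_dU2 /profile_U2.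
    by field; rewrite gt_eqF.
  (* The tolerance combines [a / 2 <= 1 / 200] or [1 / (2 b) <= 1 / 200] with
     [k^2 (D + 1) <= 1 / (100 * 100)]. *)
  apply: sum_sqr_perturb force _ _.
    rewrite -[51 / (100 * 100)]mulr1; apply: le_norm_mul => //.
    by rewrite ler_norml; apply/andP; split; lra.
  have Sg : `|sin s * (2 * profile_g N b mu s - 1)| <= 1 * 1.
    by apply: le_norm_mul => //; rewrite ler_norml; lra.
  apply: le_trans (ler_normB _ _) _.
  have h1 : `|k ^+ 2 * ddU2 s| <= k ^+ 2 * D by apply: le_norm_mul => //; rewrite ger0_norm.
  have h2 : `|(2 * b)^-1 * (sin s * (2 * profile_g N b mu s - 1))| <= (2 * b)^-1 * (1 * 1).
    by apply: le_norm_mul => //; rewrite gtr0_norm.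
  lra.
- by rewrite addr_ge0// mulr_ge0// divr_ge0.
- move=> T; have [n nT] := unbounded_multiples T c0; exists (c * (n%:R * (2 * pi))) => //.
  have [gl pl S0 C1] := profile_at_2pi b N0 mu0 n.
  have kcn : k * (c * (n%:R * (2 * pi))) = n%:R * (2 * pi) by rewrite (mulrA k c) kc mul1r.
  rewrite /dy1 /dy2 /dU2 /profile_dU2 kcn S0 C1 mul0r oppr0 mul0r sub0r mulr1.
  rewrite -/k.
  have {}pl : 1 - 1 / 500 <= profile_p N b mu (n%:R * (2 * pi)) by rewrite pl.
  have {}gl : 1 - 1 / 500 <= profile_g N b mu (n%:R * (2 * pi)).
    by apply: le_trans gl; rewrite lerD2l lerN2.
  rewrite exprMn mulrC; apply: le_trans (ler_wpM2l k20 (velocity_numerics gl pl)) _.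
  by rewrite le_eqVlt; apply/orP; left; apply/eqP; field.
Qed.

End counterexample.

(** First [mu = t - 1], so that [mu / (1 + mu) = 1 - 1 / t]; then [N = t mu]. *)
Lemma profile_parameters (R : realType) (t : R) : 1 < t -> exists N mu : R,
  [/\ 0 < N, 0 < mu, mu / N <= 1 / t & 1 - 1 / t <= mu / (1 + mu)].
Proof.
move=> t1; have t0 : 0 < t by exact: lt_trans t1.
have mu0 : 0 < t - 1 by rewrite subr_gt0.
exists (t * (t - 1)), (t - 1); split=> //.
- exact: mulr_gt0.
- by rewrite invfM mulrCA divff ?gt_eqF// mulr1 div1r.
- by rewrite (addrC 1 (t - 1)) subrK mulrBl divff ?gt_eqF.
Qed.

(** Since [r >= 0.99 c], the left side is below [2.0203 / c], while [K] is at least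
    [2.05 / (1.0102 c)], about [2.029 / c]. *)
Lemma comparison_numerics (R : realType) (c r K l : R) : 0 < c -> 0 < r ->
    l = 1 / 400 -> 100 * 100 <= c ^+ 2 -> c - 2 * l / c <= r ->
    41 / 20 / c <= K * (1 + 2 * (51 / (100 * 100))) ->
  2 / r < K.
Proof.
move=> c0 r0 lE c2 rc; rewrite ler_pdivrMr// => Kc.
have rc' : 99 / 100 * c <= r.
  apply: le_trans rc; have -> : 2 * l / c = (2 * l / c ^+ 2) * c by field; rewrite gt_eqF.
  have : 2 * l / c ^+ 2 <= 1 / 100 by rewrite ler_pdivrMr ?exprn_gt0//; lra.
  by move=> /(ler_wpM2r (ltW c0)); lra.
rewrite ltr_pdivrMr//.
have K0 : 0 < K.
  by rewrite ltNge; apply/negP => K0; have := mulr_ge0 (ltW c0) (_ : 0 <= - K); rewrite oppr_ge0 => /(_ K0); lra.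
have := ler_wpM2l (ltW K0) rc'; lra.
Qed.

Theorem corollary4p3 (R : realType) (H : completeNormedModType R)
    (ip : {dot H for idfun}) (ip_norm : inner_product_of_norm ip)
    (dim2 : dim_ge2 H) :
  exists A1 A2 : operator H,
    (self_adjoint ip A1 /\ coercive ip A1) /\
    (self_adjoint ip A2 /\ coercive ip A2) /\
    positive_op ip (op_sub A2 A1) /\
    exists2 c0 : R, 0 < c0 &
      forall c : R, c0 <= c ->
        exists K1 K2 : R,
          [/\ optimal_velocity_bound ip A1 c K1,
              optimal_velocity_bound ip A2 c K2 &
              K1 < K2].
Proof.
have [e1 [e2 [e11 e21 e12]]] := orthonormal_pair ip_norm dim2.
(* The eigenvalues are the squares, [1 / 400] for [A1] and [1 / 100], [100] for [A2]; weak solutions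
   involve the square roots. *)
pose l0 : R := 1 / 20; pose l1 : R := 1 / 10; pose l2 : R := 10.
have [l00 l10 l20] : [/\ 0 < l0, 0 < l1 & 0 < l2].
  by split; rewrite /l0 /l1 /l2; lra.
have [l0E l1E l2E] : [/\ l0 ^+ 2 = 1 / 400, l1 ^+ 2 = 1 / 100 & l2 ^+ 2 = 100].
  by split; rewrite /l0 /l1 /l2; field.
clearbody l0 l1 l2.
have [N [mu [N0 mu0 muN muP]]] := @profile_parameters R 500 (ltr1n _ _).
exists (spectral_op ip e2 (l0 ^+ 2) (l0 ^+ 2)), (spectral_op ip e2 (l1 ^+ 2) (l2 ^+ 2)).
have s0 : 0 < l0 ^+ 2 by exact: exprn_gt0.
have s1 : 0 < l1 ^+ 2 by exact: exprn_gt0.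
have s2 : 0 < l2 ^+ 2 by exact: exprn_gt0.
do 2![split; first by split; [exact: spectral_op_self_adjoint|exact: spectral_op_coercive]].
split; first by apply: spectral_op_sub_pos => //; lra.
pose D := (2 * l2 ^+ 2)^-1 + 4 + 2 * l2 ^+ 2 + 2 * N * l2 ^+ 2.
have D0 : 0 < D.
  have h1 : 0 < (2 * l2 ^+ 2)^-1 by rewrite invr_gt0 mulr_gt0.
  have h2 : 0 < 2 * N * l2 ^+ 2 by rewrite !mulr_gt0.
  by rewrite /D; lra.
(* Beyond this threshold [U'' / c^2] is negligible and all three characteristic polynomials have
   real roots. *)
exists (100 * 100 * (D + 1)) => [|c cD]; first lra.
have c100 : 100 * 100 <= c by lra.
have c0 : 0 < c by lra.
have c2 : 100 * 100 <= c ^+ 2.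
  by apply: (le_trans c100); rewrite expr2 ler_peMr ?(ltW c0)//; lra.
have [r1 [r2 [r10 r20 rc rl r2c]]] : exists r1 r2, [/\ 0 < r1, 0 < r2,
    r1 + r2 = c, r1 * r2 = l0 ^+ 2 & c - 2 * l0 ^+ 2 / c <= r2].
  by apply: char_poly_roots => //; lra.
have [q1 [q2 [q10 q20 qc ql _]]] : exists r1 r2, [/\ 0 < r1, 0 < r2,
    r1 + r2 = c, r1 * r2 = l1 ^+ 2 & c - 2 * l1 ^+ 2 / c <= r2].
  by apply: char_poly_roots => //; lra.
have [p1 [p2 [p10 p20 pc pl _]]] : exists r1 r2, [/\ 0 < r1, 0 < r2,
    r1 + r2 = c, r1 * r2 = l2 ^+ 2 & c - 2 * l2 ^+ 2 / c <= r2].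
  by apply: char_poly_roots => //; lra.
have vK1 := scalar_velocity_bound (e := e2) ip_norm r10 r20.
rewrite rl rc in vK1.
have vK2 := spectral_velocity_bound ip_norm e21 q10 q20 p10 p20 (etrans qc (esym pc)).
rewrite ql pl qc in vK2.
(* Admissible constants are bounded below by [0], so the optimal ones exist; for [A1] the estimate
   [K1 <= 2 / r2] is kept. *)
have [K1 optK1 /andP[_ K1le]] := optimal_velocity_bound_exists vK1
  (fun K' vK' => ltW (velocity_bound_gt0 ip_norm e11 e21 e12 (ltW l00) (ltW l00) c0 vK')).
have [K2 optK2 _] := optimal_velocity_bound_exists vK2
  (fun K' vK' => ltW (velocity_bound_gt0 ip_norm e11 e21 e12 (ltW l10) (ltW l20) c0 vK')).
exists K1, K2; split=> //.
have l1a : l1 ^+ 2 <= 1 / 100 by rewrite l1E.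
have l2b : 100 <= l2 ^+ 2 by rewrite l2E.
have K2ge := anisotropic_lower_bound ip_norm e11 e21 e12 l10 l1a l20 l2b N0 mu0 muN muP cD
  (proj1 optK2).
apply: le_lt_trans K1le _.
exact: (comparison_numerics c0 r20 l0E c2 r2c K2ge).
Qed.
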